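(* Let $u,v\in C_0^+(\mathbb{Z}^d)$ be admissible, $u^*=R_{\mathbb{Z}^d}u$, $v^*=R_{\mathbb{Z}^d}v$, let $H:\mathbb{R}_+\to\mathbb{R}_+$ be a decreasing function, and let $G:\mathbb{R}_+\times\mathbb{R}_+\to\mathbb{R}_+$ be a supermodular function with $G(0,0)=0$. Then $$\sum_{x,y\in\mathbb{Z}^d}G(u(x),v(y))H(d(x,y))\le\sum_{x,y\in\mathbb{Z}^d}G(u^*(x),v^*(y))H(d(x,y)).$$ Moreover, if $u=u^*$ with $\operatorname{ran}u=[a_1>a_2>\cdots]$, $G$ is strictly supermodular, $H(n)>H(n+1)$ for some $n\in\mathbb{N}$, and $\left|\sum_{x,y\in\mathbb{Z}^d}G(u^*(x),v^*(y))H(d(x,y))\right|<\infty$, then equality holds if and only if $v=v^*$.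
   Context: $\mathbb{R}_+=[0,\infty)$, $\mathbb{N}=\{0,1,2,\dots\}$, $d\ge1$ is an integer, $e_i$ is the $i$-th standard unit vector, $\langle\cdot,\cdot\rangle$ the Euclidean inner product; ''decreasing'' means nonincreasing. On $\mathbb{Z}^d$, $d(x,y)=\sum_{i=1}^d|x^i-y^i|$ is the graph distance of the lattice graph. Sums of nonnegative terms take values in $[0,\infty]$. Supermodular: $G(s+s_0,t+t_0)+G(s,t)\ge G(s,t+t_0)+G(s+s_0,t)$ for all $s,t,s_0,t_0\ge0$; strictly supermodular if moreover the inequality is strict whenever $s_0,t_0>0$. Admissible functions: $u\in C_0^+(\mathbb{Z}^d)$ means $u:\mathbb{Z}^d\to\mathbb{R}_+$ with $\{u>t\}$ finite for all $t>0$ (similarly on $\mathbb{Z}$ or $\mathbb{Z}+1/2$). The $n$-th largest value of $u$ is $a_n=\sup_{|\Omega|=n}\min_{\Omega}u$, $n\ge1$; $\operatorname{ran}u=[a_1>a_2>\cdots]$ means that $a_n>a_{n+1}$ for all $n\ge1$. One-dimensional rearrangement: for $w$ admissible on $\mathbb{Z}$ or on $\mathbb{Z}+1/2$ with largest values $a_1\ge a_2\ge\cdots$ (with multiplicity), $R_{\mathbb{Z}}w(x)=a_{1-2x}$ if $x\le0$ and $R_{\mathbb{Z}}w(x)=a_{2x}$ if $x>0$. Rearrangement on $\mathbb{Z}^d$: let $\vec E=\{e_i,\frac{e_i+e_j}{2},\frac{e_i-e_j}{2}:1\le i<j\le d\}$ (all $e_i$, $1\le i\le d$, included). For $e\in\vec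 E$, partition $\mathbb{Z}^d$ into the classes of the relation ''$x-y$ is parallel to $e$''; on each class $V$ the map $x\mapsto\langle e,x\rangle$ is a bijection onto $\mathbb{Z}$ or $\mathbb{Z}+1/2$, and the one-step rearrangement $R_eu$ is defined by $(R_eu)|_V=R_{\mathbb{Z}}(u|_V)$ under this identification. Fix an enumeration of $\vec E$ (for $d=2$: $e_1,e_2,\frac{e_1+e_2}{2},\frac{e_1-e_2}{2}$); $R^ku$ is obtained from $u$ by applying successively the first $k$ of the operators $R_e$ in the sequence obtained by repeating this enumeration cyclically. The Schwarz rearrangement is $R_{\mathbb{Z}^d}u(x)=\lim_{k\to\infty}R^ku(x)$, $x\in\mathbb{Z}^d$ (the limit exists). *)

(* Defs.v *)
From HB Require Import structures.
From mathcomp Require Import all_boot all_order all_algebra.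
From mathcomp Require Import all_classical all_reals all_analysis.

Set Implicit Arguments.
Unset Strict Implicit.
Unset Printing Implicit Defensive.

Import Order.TTheory GRing.Theory Num.Theory.
Import numFieldNormedType.Exports.

Local Open Scope classical_set_scope.
Local Open Scope ring_scope.

(* Functions on R_+ are represented by functions on R, all conditions being
   imposed at nonnegative arguments only. *)

Definition maps_Rplus (R : realType) (H : R -> R) : Prop :=
  forall s, 0 <= s -> 0 <= H s.

Definition maps_Rplus2 (R : realType) (G : R -> R -> R) : Prop :=
  forall s t, 0 <= s -> 0 <= t -> 0 <= G s t.

Definition decreasing_Rplus (R : realType) (H : R -> R) : Prop :=
  forall s t, 0 <= s -> s <= t -> H t <= H s.

Definition supermodular (R : realType) (G : R -> R -> R) : Prop :=
  forall s t s0 t0, 0 <= s -> 0 <= t -> 0 <= s0 -> 0 <= t0 ->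
    G s (t + t0) + G (s + s0) t <= G (s + s0) (t + t0) + G s t.

Definition strictly_supermodular (R : realType) (G : R -> R -> R) : Prop :=
  supermodular G /\
  forall s t s0 t0, 0 <= s -> 0 <= t -> 0 < s0 -> 0 < t0 ->
    G s (t + t0) + G (s + s0) t < G (s + s0) (t + t0) + G s t.

Definition admissible (R : realType) (T : Type) (u : T -> R) : Prop :=
  (forall x, 0 <= u x) /\ (forall t, 0 < t -> finite_set [set x | t < u x]).

(* The n-th largest value, n >= 1, of the restriction of u to D; since the sets
   Omega are finite, the inf over Omega is a min. *)
Definition nth_largest (R : realType) (T : choiceType) (D : set T) (u : T -> R)
    (n : nat) : R :=
  sup [set inf (u @` Omega) |
        Omega in [set Omega : set T | Omega `<=` D /\ (Omega #= `I_n)%card]].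

Definition strict_range (R : realType) (T : choiceType) (u : T -> R) : Prop :=
  forall n, (1 <= n)%N -> nth_largest setT u n.+1 < nth_largest setT u n.

(* The rearrangement of w|_V, where phi identifies V with Z or Z + 1/2. On the
   image of V, 1 - 2 * phi x and 2 * phi x are integers, so that truncn is exact
   in the branch where it is used. *)
Definition rearrange_Z (R : realType) (T : choiceType) (V : set T)
    (phi : T -> rat) (w : T -> R) (x : T) : R :=
  if phi x <= 0 then nth_largest V w (Num.truncn (1 - 2 * phi x))
  else nth_largest V w (Num.truncn (2 * phi x)).

Notation lattice d := 'rV[int]_d.

Definition graph_dist (d : nat) (x y : lattice d) : nat :=
  (\sum_(i < d) `|x 0%R i - y 0%R i|)%N.

Definition unit_vec (d : nat) (i : 'I_d) : 'rV[rat]_d := delta_mx 0 i.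

Definition is_direction (d : nat) (e : 'rV[rat]_d) : Prop :=
  (exists i : 'I_d, e = unit_vec i) \/
  (exists i j : 'I_d, (i < j)%N /\
     (e = 2^-1 *: (unit_vec i + unit_vec j) \/
      e = 2^-1 *: (unit_vec i - unit_vec j))).

Definition enumerates_directions (d : nat) (es : seq 'rV[rat]_d) : Prop :=
  uniq es /\ forall e, e \in es <-> is_direction e.

Definition inner (d : nat) (e : 'rV[rat]_d) (x : lattice d) : rat :=
  \sum_(i < d) e 0 i * (x 0 i)%:~R.

Definition parallel_class (d : nat) (e : 'rV[rat]_d) (x : lattice d) :
    set (lattice d) :=
  [set y | exists c : rat, map_mx intr (x - y) = c *: e].

Definition rearrange_step (R : realType) (d : nat) (e : 'rV[rat]_d)
    (u : lattice d -> R) (x : lattice d) : R :=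
  rearrange_Z (parallel_class e x) (inner e) u x.

Fixpoint rearrange_iter (R : realType) (d : nat) (es : seq 'rV[rat]_d)
    (u : lattice d -> R) (k : nat) : lattice d -> R :=
  if k is k'.+1 then
    rearrange_step (nth 0 es (k' %% size es)%N) (rearrange_iter es u k')
  else u.

Definition schwarz (R : realType) (d : nat) (es : seq 'rV[rat]_d)
    (u : lattice d -> R) (x : lattice d) : R :=
  limn (fun k => rearrange_iter es u k x).

Definition riesz_sum (R : realType) (d : nat) (G : R -> R -> R) (H : R -> R)
    (u v : lattice d -> R) : \bar R :=
  \esum_(p in [set: lattice d * lattice d])
    (G (u p.1) (v p.2) * H (graph_dist p.1 p.2)%:R)%:E.

(* Main.v *)
Require Import Defs.
From HB Require Import structures.
From mathcomp Require Import all_boot all_order all_algebra.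
From mathcomp Require Import finmap.
From mathcomp Require Import all_classical all_reals all_analysis.
From mathcomp Require Import zify ring lra.

Set Implicit Arguments.
Unset Strict Implicit.
Unset Printing Implicit Defensive.

Import Order.TTheory GRing.Theory Num.Theory.
Import numFieldNormedType.Exports.

Local Open Scope classical_set_scope.
Local Open Scope ring_scope.

(** Every one-step rearrangement is a limit of polarizations. Along a line of
    direction e the target order of the positions is 0, 1, -1, 2, -2, ... (or
    1/2, -1/2, 3/2, ...), and consecutive positions are exchanged by one of the
    two reflections s -> -s and s -> 1 - s. Both extend to isometries of the
    graph distance on the whole lattice, and both are folding: moving a point
    to the side of another one does not increase their distance. Polarizing u
    and v, that is, putting on each orbit {x, sg x} the larger value on the
    preferred side, therefore does not decrease the sum of
    G (u x) (v y) * H (d (x, y)): group the four terms of the orbits of x and y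
    and use that G is supermodular and H decreasing ([pair_sum_polarize_le]).

    For a function with finite support, the two polarizations attached to e,
    applied in turn, become stationary: each effective one lowers an energy with
    values in nat, the sum of (rank of the value) * (weight of the position),
    where the weight is a slightly tilted squared Euclidean norm that every
    reflection in every direction increases on its preferred side. A function
    that both polarizations fix is decreasing along the order of each line, so
    it equals its one-step rearrangement ([rearrange_step_fixed]); since
    polarizing does not change how many values on a line exceed t, the
    stationary function is the rearrangement of the initial one
    ([alternate_stabilizes]). The same energy makes the iteration of all the
    one-step rearrangements stationary.

    An admissible function is reduced to finite support by cutting off its
    values below t > 0. This commutes with the rearrangements, it does not
    increase G (u x) (v y) because G >= 0 and G 0 0 = 0, and for small t it leaves any
    finite part of the sum unchanged ([pair_sum_truncate_le]). It also shows
    that the limit defining the Schwarz rearrangement exists, and that its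
    truncations are finite iterates ([schwarz_truncate]).

    If v is not its own Schwarz rearrangement, some step changes it, hence so
    does one of the two polarizations of that step: v y < v (sg y) for some
    preferred y. Moving y away from the mirror by n units gives x with
    d (x, y) = n < d (x, sg y), so H separates these distances. A rearranged u
    with infinitely many distinct largest values is positive everywhere and
    injective, so u (sg x) < u x, and the polarization strictly increases the
    finite sum ([riesz_step_lt]). *)

(** * Directions, lines and reflections of the lattice *)

(** When q x is twice the coordinate of x on its line and f the step of the
    line, this is the reflection s -> c - s of that coordinate. *)
Definition reflect_axis (d : nat) (f : lattice d) (q : lattice d -> int)
    (c : bool) (x : lattice d) : lattice d :=
  x + (c%:Z - q x) *: f.

(** The side of the mirror whose points come first in the order
    0, 1, -1, 2, -2, ... or 1/2, -1/2, 3/2, ...: the positive half-line for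
    s -> -s, and the half-line s <= 0 for s -> 1 - s. *)
Definition near_side (d : nat) (q : lattice d -> int) (c : bool) :
    pred (lattice d) :=
  fun x => if c then q x < 1 else 0 < q x.

(** Up to the factor d + 1, the weight of x is |x|^2 - <b, x> with
    b_i = (d - i) / (d + 1), i counted from 0. As 1 > b_0 > b_1 > ... > 0, the
    inner product of b with every direction lies strictly between 0 and 1, so
    on each line the weight increases along the order 0, 1, -1, 2, -2, ... (or
    1/2, -1/2, 3/2, ...) of the positions. *)
Definition weight_term (d : nat) (i : 'I_d) (a : int) : int :=
  a * (d.+1%:Z * a - (d - i)%N%:Z).

Definition weight (d : nat) (x : lattice d) : nat :=
  absz (\sum_(i < d) weight_term i (x ord0 i)).

(** What the proof uses of a direction e. The vector f generates the lattice
    points of the lines of direction e, and q is twice the coordinate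
    <e, x>, which makes it an integer. *)
Record axis (d : nat) (e : 'rV[rat]_d) (f : lattice d)
    (q : lattice d -> int) : Prop := Axis {
  axis_inner : forall x, inner e x = (q x)%:~R / 2;
  axis_class : forall x y,
    parallel_class e x y <-> exists m : int, y = x + m *: f;
  axis_shift : forall x m, q (x + m *: f) = q x + 2 * m;
  axis_isometry : forall c x y,
    graph_dist (reflect_axis f q c x) (reflect_axis f q c y) = graph_dist x y;
  axis_fold : forall c x y, near_side q c x -> near_side q c y ->
    (graph_dist x y <= graph_dist x (reflect_axis f q c y))%N;
  axis_separates : forall c y (n : nat), near_side q c y ->
    exists x, [/\ near_side q c x, graph_dist x y = n
      & (n < graph_dist x (reflect_axis f q c y))%N];
  axis_weight : forall c x, near_side q c x ->
    (weight x < weight (reflect_axis f q c x))%N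
}.

Lemma graph_dist_split1 (d : nat) (i : 'I_d) (x y : lattice d) :
  graph_dist x y =
    (`|x ord0 i - y ord0 i| + \sum_(k < d | k != i) `|x ord0 k - y ord0 k|)%N.
Proof. by rewrite /graph_dist (bigD1 i). Qed.

Lemma graph_dist_split2 (d : nat) (i j : 'I_d) (x y : lattice d) : i != j ->
  graph_dist x y =
    (`|x ord0 i - y ord0 i| + (`|x ord0 j - y ord0 j|
     + \sum_(k < d | (k != i) && (k != j)) `|x ord0 k - y ord0 k|))%N.
Proof.
by move=> ij; rewrite (graph_dist_split1 i) (bigD1 j) //= eq_sym.
Qed.

Lemma weight_term_ge0 (d : nat) (i : 'I_d) (a : int) : 0 <= weight_term i a.
Proof.
rewrite /weight_term; have := ltn_ord i; case: (lerP a 0) => a0 id.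
  by rewrite mulr_le0 // subr_le0; nia.
by rewrite mulr_ge0 ?subr_ge0 //; nia.
Qed.

Lemma weightE (d : nat) (x : lattice d) :
  (weight x)%:Z = \sum_(i < d) weight_term i (x ord0 i).
Proof.
by rewrite /weight gez0_abs // sumr_ge0 // => i _; apply: weight_term_ge0.
Qed.

Lemma weight_lt1 (d : nat) (i : 'I_d) (x y : lattice d) :
  (forall k, k != i -> y ord0 k = x ord0 k) ->
  weight_term i (x ord0 i) < weight_term i (y ord0 i) ->
  (weight x < weight y)%N.
Proof.
move=> eq_xy lt_xy; suff : (weight x)%:Z < (weight y)%:Z by lia.
rewrite !weightE (bigD1 i) // [ltRHS](bigD1 i) //=.
rewrite [X in _ < _ + X](eq_bigr (fun k => weight_term k (x ord0 k))).
  by rewrite ltrD2r.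
by move=> k ki; rewrite eq_xy.
Qed.

Lemma weight_lt2 (d : nat) (i j : 'I_d) (x y : lattice d) : i != j ->
  (forall k, k != i -> k != j -> y ord0 k = x ord0 k) ->
  weight_term i (x ord0 i) + weight_term j (x ord0 j) <
  weight_term i (y ord0 i) + weight_term j (y ord0 j) ->
  (weight x < weight y)%N.
Proof.
move=> ij eq_xy lt_xy; suff : (weight x)%:Z < (weight y)%:Z by lia.
have ji : j != i by rewrite eq_sym.
rewrite !weightE (bigD1 i) // [ltRHS](bigD1 i) //= (bigD1 j) //.
rewrite [X in _ < _ + X](bigD1 j) //= !addrA.
rewrite [X in _ < _ + X](eq_bigr (fun k => weight_term k (x ord0 k))).
  by rewrite ltrD2r.
by move=> k /andP[ki kj]; rewrite eq_xy.
Qed.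

Lemma inner_delta (d : nat) (i : 'I_d) (x : lattice d) :
  inner (unit_vec i) x = (x ord0 i)%:~R.
Proof.
rewrite /inner (bigD1 i) //= big1 ?addr0 ?mxE ?eqxx ?mul1r // => k /negPf ki.
by rewrite mxE ki andbF mul0r.
Qed.

Lemma innerZ (d : nat) (a : rat) (e : 'rV[rat]_d) x :
  inner (a *: e) x = a * inner e x.
Proof.
by rewrite /inner mulr_sumr; apply: eq_bigr => i _; rewrite mxE mulrA.
Qed.

Lemma innerD (d : nat) (e e' : 'rV[rat]_d) x :
  inner (e + e') x = inner e x + inner e' x.
Proof.
by rewrite /inner -big_split; apply: eq_bigr => i _; rewrite mxE mulrDl.
Qed.

(** The second hypothesis says that a lattice vector parallel to e is an integer
    multiple of f; for the directions at hand one coordinate shows it. *)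
Lemma parallel_classP (d : nat) (e : 'rV[rat]_d) (f : lattice d) (a : rat) x y :
  a != 0 -> map_mx intr f = a *: e ->
  (forall c : rat, map_mx intr (x - y) = c *: e ->
     exists m : int, c = a * m%:~R) ->
  parallel_class e x y <-> exists m : int, y = x + m *: f.
Proof.
move=> a0 fe int_c; split.
  case=> c xyc; have [m cm] := int_c c xyc; exists (- m).
  apply/rowP => k; rewrite !mxE.
  apply/eqP; rewrite -(eqr_int rat); apply/eqP.
  have /(congr1 (fun M : 'rV[rat]_d => M ord0 k)) := xyc; rewrite !mxE => hxy.
  have /(congr1 (fun M : 'rV[rat]_d => M ord0 k)) := fe; rewrite !mxE => hf.
  rewrite rmorphD rmorphM rmorphN /= hf.
  rewrite rmorphB cm /= in hxy.
  have -> : ((y ord0 k)%:~R : rat) = (x ord0 k)%:~R - (a * m%:~R * e ord0 k).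
    by rewrite -hxy; ring.
  ring.
case=> m ->; exists (- (a * m%:~R)); apply/rowP => k.
have := congr1 (fun M : 'rV[rat]_d => M ord0 k) fe; rewrite !mxE.
rewrite !rmorphD !rmorphN !rmorphD !rmorphM /= => ->; ring.
Qed.

(** For e_i only the i-th coordinate moves, and all the claims are about
    |a - b| on the integers. *)
Section CoordinateAxis.
Variables (d : nat) (i : 'I_d).

Let f : lattice d := delta_mx ord0 i.
Let q (x : lattice d) : int := 2 * x ord0 i.

Let fi : f ord0 i = 1. Proof. by rewrite mxE !eqxx. Qed.
Let fk k : k != i -> f ord0 k = 0.
Proof. by move=> /negPf ki; rewrite mxE ki andbF. Qed.

Let shift_i (x : lattice d) (m : int) : (x + m *: f) ord0 i = x ord0 i + m.
Proof. by rewrite 2!mxE fi mulr1. Qed.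
Let shift_k (x : lattice d) (m : int) k : k != i -> (x + m *: f) ord0 k = x ord0 k.
Proof. by move=> ki; rewrite 2!mxE fk // mulr0 addr0. Qed.

Let dist_shift (x y : lattice d) (m n : int) :
  graph_dist (x + m *: f) (y + n *: f) =
    (absz ((x ord0 i + m) - (y ord0 i + n))%R
     + \sum_(k < d | k != i) `|x ord0 k - y ord0 k|)%N.
Proof.
rewrite (graph_dist_split1 i) !shift_i; congr addn.
by apply: eq_bigr => k ki; rewrite !shift_k.
Qed.

Let shift0 (x : lattice d) : x = x + 0 *: f.
Proof. by rewrite scale0r addr0. Qed.

Lemma axis_unit_vec : axis (unit_vec i) f q.
Proof.
split.
- by move=> x; rewrite inner_delta /q rmorphM /=; field.
- move=> x y; apply: (@parallel_classP _ _ _ 1) => //.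
    by apply/rowP => k; rewrite !mxE mul1r; case: (_ && _).
  move=> c /(congr1 (fun M : 'rV[rat]_d => M ord0 i)); rewrite !mxE !eqxx.
  by rewrite mulr1 => <-; exists (x ord0 i - y ord0 i); rewrite mul1r.
- by move=> x m; rewrite /q shift_i mulrDr.
- move=> c x y; rewrite /reflect_axis dist_shift (graph_dist_split1 i) /q.
  by congr addn; case: c; lia.
- move=> c x y xs ys.
  rewrite /reflect_axis {2}(shift0 x) dist_shift (graph_dist_split1 i).
  rewrite leq_add2r; move: xs ys; rewrite /near_side /q; case: c; lia.
- move=> c y n ys.
  exists (y + (if c then - n%:Z else n%:Z) *: f); split.
  + by move: ys; rewrite /near_side /q shift_i; case: c; lia.
  + rewrite {2}(shift0 y) dist_shift big1 ?addn0; first by case: c {ys}; lia.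
    by move=> k _; rewrite subrr.
  + rewrite /reflect_axis dist_shift big1 ?addn0; last first.
      by move=> k _; rewrite subrr.
    by move: ys; rewrite /near_side /q; case: c; lia.
- move=> c x xs; apply: (@weight_lt1 _ i); rewrite /reflect_axis.
    by move=> k ki; rewrite shift_k.
  rewrite shift_i /weight_term; have := ltn_ord i.
  move: xs; rewrite /near_side /q; set a := x ord0 i; case: c => xs id.
    have -> : a + (true%:Z - 2 * a) = 1 - a by lia.
    by nia.
  have -> : a + (false%:Z - 2 * a) = - a by lia.
  by nia.
Qed.

End CoordinateAxis.

(** For (e_i + eps e_j) / 2 the two moving coordinates contribute
    |a| + |b| = max (|a + b|, |a - b|) to a distance, one of the two arguments
    being constant along the line: this is why the reflections fold the graph
    distance. The hypothesis i < j fixes the sign in front of e_i, which decides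
    which side of a mirror comes first. *)
Section DiagonalAxis.
Variables (d : nat) (i j : 'I_d) (eps : int).
Hypotheses (lt_ij : (i < j)%N) (eps1 : eps = 1 \/ eps = -1).

Let f : lattice d := delta_mx ord0 i + eps *: delta_mx ord0 j.
Let q (x : lattice d) : int := x ord0 i + eps * x ord0 j.
Let e : 'rV[rat]_d := 2^-1 *: (unit_vec i + eps%:~R *: unit_vec j).

Let ij : i != j. Proof. by rewrite neq_ltn lt_ij. Qed.
Let fi : f ord0 i = 1.
Proof. by rewrite !mxE !eqxx (negPf ij) mulr0 addr0. Qed.
Let fj : f ord0 j = eps.
Proof. by rewrite !mxE !eqxx eq_sym (negPf ij) mulr1 add0r. Qed.
Let fk k : k != i -> k != j -> f ord0 k = 0.
Proof.
by move=> /negPf ki /negPf kj; rewrite !mxE ki kj !andbF mulr0 addr0.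
Qed.

Let shift_i (x : lattice d) (m : int) : (x + m *: f) ord0 i = x ord0 i + m.
Proof. by rewrite 2!mxE fi mulr1. Qed.
Let shift_j (x : lattice d) (m : int) :
  (x + m *: f) ord0 j = x ord0 j + eps * m.
Proof. by rewrite 2!mxE fj mulrC. Qed.
Let shift_k (x : lattice d) (m : int) k : k != i -> k != j ->
  (x + m *: f) ord0 k = x ord0 k.
Proof. by move=> ki kj; rewrite 2!mxE fk // mulr0 addr0. Qed.

Let dist_shift (x y : lattice d) (m n : int) :
  graph_dist (x + m *: f) (y + n *: f) =
    (absz ((x ord0 i + m) - (y ord0 i + n))%R
     + (absz ((x ord0 j + eps * m) - (y ord0 j + eps * n))%R
     + \sum_(k < d | (k != i) && (k != j)) `|x ord0 k - y ord0 k|))%N.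
Proof.
rewrite (graph_dist_split2 _ _ ij) !shift_i !shift_j.
congr (_ + (_ + _))%N.
by apply: eq_bigr => k /andP[ki kj]; rewrite !shift_k.
Qed.

Let shift0 (x : lattice d) : x = x + 0 *: f.
Proof. by rewrite scale0r addr0. Qed.

Lemma axis_diagonal : axis e f q.
Proof.
split.
- move=> x; rewrite /e innerZ innerD innerZ !inner_delta /q.
  by rewrite rmorphD rmorphM /=; field.
- move=> x y; apply: (@parallel_classP _ _ _ 2) => //.
    apply/rowP => k; rewrite !mxE rmorphD rmorphM /=.
    by rewrite !rmorph_nat; field.
  move=> c /(congr1 (fun M : 'rV[rat]_d => M ord0 i)).
  rewrite !mxE !eqxx (negPf ij) mulr0 addr0 mulr1 => h.
  by exists (x ord0 i - y ord0 i); rewrite h; field.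
- move=> x m; rewrite /q shift_i shift_j.
  by case: eps1 => ->; lia.
- move=> c x y; rewrite /reflect_axis dist_shift (graph_dist_split2 _ _ ij) /q.
  by rewrite !addnA; congr addn; case: eps1 => ->; case: c; lia.
- move=> c x y xs ys.
  rewrite /reflect_axis {2}(shift0 x) dist_shift (graph_dist_split2 _ _ ij).
  rewrite !addnA leq_add2r; move: xs ys; rewrite /near_side /q.
  by case: eps1 => ->; case: c; lia.
  (* Away from the mirror along e_i: this lengthens the distance to the
     reflected point by n, while staying at distance n from y. *)
- move=> c y n ys; pose g : lattice d := delta_mx ord0 i.
  have gi : g ord0 i = 1 by rewrite mxE !eqxx.
  have gk k : k != i -> g ord0 k = 0.
    by move=> /negPf ki; rewrite mxE ki andbF.
  pose x := y + (if c then - n%:Z else n%:Z) *: g.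
  have xi : x ord0 i = y ord0 i + (if c then - n%:Z else n%:Z).
    by rewrite 2!mxE gi mulr1.
  have xk k : k != i -> x ord0 k = y ord0 k.
    by move=> ki; rewrite 2!mxE gk // mulr0 addr0.
  have xj : x ord0 j = y ord0 j by rewrite xk // eq_sym.
  clearbody x; exists x; split.
  + by move: ys; rewrite /near_side /q xi xj {xi}; case: c; lia.
  + rewrite (graph_dist_split1 i) xi big1 ?addn0; first by case: c {ys xi}; lia.
    by move=> k ki; rewrite xk // subrr.
  + rewrite /reflect_axis (shift0 x) dist_shift xi xj; apply: leq_trans (leq_addr _ _).
    move: ys; rewrite /near_side /q {xi}.
    by case: eps1 => ->; case: c; lia.
- move=> c x xs; apply: (weight_lt2 ij); rewrite /reflect_axis.
    by move=> k ki kj; rewrite shift_k.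
  rewrite shift_i shift_j /weight_term; have := ltn_ord j.
  move: xs; rewrite /near_side /q; set a := x ord0 i; set b := x ord0 j.
  move: lt_ij; case: eps1 => ->; case: c => ij_ xs jd.
  + have -> : a + (true%:Z - (a + 1 * b)) = 1 - b by lia.
    have -> : b + 1 * (true%:Z - (a + 1 * b)) = 1 - a by lia.
    by nia.
  + have -> : a + (false%:Z - (a + 1 * b)) = - b by lia.
    have -> : b + 1 * (false%:Z - (a + 1 * b)) = - a by lia.
    by nia.
  + have -> : a + (true%:Z - (a + -1 * b)) = 1 + b by lia.
    have -> : b + -1 * (true%:Z - (a + -1 * b)) = a - 1 by lia.
    by nia.
  + have -> : a + (false%:Z - (a + -1 * b)) = b by lia.
    have -> : b + -1 * (false%:Z - (a + -1 * b)) = a by lia.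
    by nia.
Qed.

End DiagonalAxis.

Lemma direction_axis (d : nat) (e : 'rV[rat]_d) : is_direction e ->
  exists f q, axis e f q.
Proof.
case=> [[i ->]|[i [j [ij [->|->]]]]].
- by eexists; eexists; apply: axis_unit_vec.
- rewrite -[unit_vec j]scale1r -[1]/((1 : int)%:~R).
  by eexists; eexists; apply: axis_diagonal => //; left.
- rewrite -scaleN1r -[-1]/((-1 : int)%:~R).
  by eexists; eexists; apply: axis_diagonal => //; right.
Qed.

(** * Polarization increases supermodular sums *)

(** Some points may lie on the mirror; they are on neither side. *)
Record reflection (T : Type) (sg : T -> T) (near : pred T) : Prop :=
Reflection {
  reflectionK : involutive sg;
  reflection_near : forall x, near x -> ~~ near (sg x);
  reflection_fixed : forall x, ~~ near x -> ~~ near (sg x) -> sg x = x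
}.

(** The finiteness of the larger sum is what excludes +oo on both sides. *)
Lemma esum_lt (R : realType) (T : choiceType) (a b : T -> R) (p : T) :
  (forall x, 0 <= a x) -> (forall x, a x <= b x) -> a p < b p ->
  (\esum_(x in [set: T]) (b x)%:E < +oo)%E ->
  (\esum_(x in [set: T]) (a x)%:E < \esum_(x in [set: T]) (b x)%:E)%E.
Proof.
move=> a0 ab abp.
have -> : \esum_(x in [set: T]) (b x)%:E =
    (\esum_(x in [set: T]) (a x)%:E + \esum_(x in [set: T]) (b x - a x)%:E)%E.
  rewrite -esumD => [|x _|x _]; rewrite ?lee_fin ?subr_ge0 //.
  by apply: eq_esum => x _; rewrite -EFinD addrC subrK.
have pos : (0 < \esum_(x in [set: T]) (b x - a x)%:E)%E.
  apply: (@lt_le_trans _ _ (b p - a p)%:E); first by rewrite lte_fin subr_gt0.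
  by apply: esum_ge; exists [set p]; [split|rewrite fsbig_set1].
have a0' : (0 <= \esum_(x in [set: T]) (a x)%:E)%E.
  by apply: esum_ge0 => x _; rewrite lee_fin.
move: a0' pos.
case: (esum _ _) => [r| |] // _; case: (esum _ _) => [s| |] // s0 _.
by rewrite -EFinD lte_fin ltrDl -lte_fin.
Qed.

Section Polarization.
Variables (R : realType) (T : choiceType) (sg : T -> T) (near : pred T).
Hypothesis refl : reflection sg near.

Definition polarize (u : T -> R) (x : T) : R :=
  if near x then Num.max (u x) (u (sg x)) else Num.min (u x) (u (sg x)).

(** A polarization swaps the values of some orbits; as a rearrangement of u by
    an involution it keeps everything that depends only on how many values
    exceed a level. *)
Lemma polarize_perm (u : T -> R) : exists pi : T -> T,
  [/\ involutive pi, forall x, pi x = x \/ pi x = sg x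
    & polarize u = u \o pi].
Proof.
have [sgK near_sg sg_fix] := refl.
pose swapped x := if near x then u x < u (sg x) else
  if near (sg x) then u (sg x) < u x else false.
exists (fun x => if swapped x then sg x else x); split.
- move=> x; have swapped_sg : swapped x -> swapped (sg x).
    rewrite /swapped sgK; have [nx|nx] := boolP (near x).
      by rewrite (negPf (near_sg _ nx)).
    by case: ifP.
  by case sx: (swapped x); rewrite ?swapped_sg ?sgK ?sx.
- by move=> x; case: ifP; [right|left].
- apply/funext => x; rewrite /polarize /swapped /=.
  have [nx|nx] := boolP (near x).
    by case: ltP.
  have [nsx|nsx] := boolP (near (sg x)); first by rewrite minC; case: ltP.
  by rewrite (sg_fix _ nx nsx) minxx.
Qed.

Lemma polarize_pair (u : T -> R) x :
  (polarize u x = u x /\ polarize u (sg x) = u (sg x)) \/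
  (polarize u x = u (sg x) /\ polarize u (sg x) = u x).
Proof.
have [sgK near_sg sg_fix] := refl; rewrite /polarize sgK.
have [nx|nx] := boolP (near x).
  rewrite (negPf (near_sg _ nx)).
  by rewrite [Num.min (u (sg x)) _]minC; case: ltP; [right|left].
have [nsx|nsx] := boolP (near (sg x)).
  by rewrite [Num.max (u (sg x)) _]maxC; case: ltP; [left|right].
by rewrite (sg_fix _ nx nsx) minxx; left.
Qed.

Lemma polarize_near (u : T -> R) x : near x ->
  polarize u x = Num.max (u x) (u (sg x)) /\
  polarize u (sg x) = Num.min (u x) (u (sg x)).
Proof.
have [sgK near_sg _] := refl => nx.
by rewrite /polarize sgK nx (negPf (near_sg _ nx)) minC.
Qed.

Lemma polarize_ge0 (u : T -> R) : (forall x, 0 <= u x) ->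
  forall x, 0 <= polarize u x.
Proof. by have [pi [_ _ ->]] := polarize_perm u => u0 x /=. Qed.

Variables (G : R -> R -> R) (K : T -> T -> R).
Hypotheses (hG : maps_Rplus2 G) (Gsuper : supermodular G).
Hypotheses (K0 : forall x y, 0 <= K x y)
  (Ksg : forall x y, K (sg x) (sg y) = K x y)
  (Kfold : forall x y, near x -> near y -> K x (sg y) <= K x y).

Definition pair_sum (u v : T -> R) : \bar R :=
  \esum_(p in [set: T * T]) (G (u p.1) (v p.2) * K p.1 p.2)%:E.

(** The terms of the four pairs in the orbit of (x, y), collected using
    K (sg x) y = K x (sg y). *)
Definition quad (u v : T -> R) (p : T * T) : R :=
  (G (u p.1) (v p.2) + G (u (sg p.1)) (v (sg p.2))) * K p.1 p.2 +
  (G (u (sg p.1)) (v p.2) + G (u p.1) (v (sg p.2))) * K p.1 (sg p.2).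

Lemma quad_ge0 u v : (forall x, 0 <= u x) -> (forall x, 0 <= v x) ->
  forall p, 0 <= quad u v p.
Proof.
by move=> u0 v0 p; rewrite addr_ge0 // mulr_ge0 ?K0 // addr_ge0 // hG.
Qed.

Let K_sgl x y : K (sg x) y = K x (sg y).
Proof. by have [sgK _ _] := refl; rewrite -Ksg sgK. Qed.

Lemma quad_sgl u v x y : quad u v (sg x, y) = quad u v (x, y).
Proof.
have [sgK _ _] := refl; rewrite /quad /= !sgK Ksg K_sgl; ring.
Qed.

Lemma quad_sgr u v x y : quad u v (x, sg y) = quad u v (x, y).
Proof. have [sgK _ _] := refl; rewrite /quad /= !sgK; ring. Qed.

Lemma supermodular_le s t s' t' : 0 <= s -> s <= s' -> 0 <= t -> t <= t' ->
  G s t' + G s' t <= G s' t' + G s t.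
Proof.
move=> s0 ss t0 tt; have := @Gsuper s t (s' - s) (t' - t) s0 t0.
by rewrite !subr_ge0 ![_ + (_ - _)]addrC !subrK; apply.
Qed.

(** Supermodularity prefers to pair the larger values together, so the best
    arrangement gives this pairing the larger weight h. *)
Lemma supermodular_sort s1 s2 t1 t2 h h' :
  0 <= s1 -> 0 <= s2 -> 0 <= t1 -> 0 <= t2 -> h' <= h ->
  (G s1 t1 + G s2 t2) * h + (G s2 t1 + G s1 t2) * h' <=
  (G (Num.max s1 s2) (Num.max t1 t2) + G (Num.min s1 s2) (Num.min t1 t2)) * h +
  (G (Num.min s1 s2) (Num.max t1 t2) + G (Num.max s1 s2) (Num.min t1 t2)) * h'.
Proof.
move=> s10 s20 t10 t20 hh.
case: (ltP s1 s2) => s12; case: (ltP t1 t2) => t12.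
- by rewrite le_eqVlt; apply/orP; left; apply/eqP; ring.
- have := supermodular_le s10 (ltW s12) t20 t12; nra.
- have := supermodular_le s20 s12 t10 (ltW t12); nra.
- by rewrite le_eqVlt; apply/orP; left; apply/eqP; ring.
Qed.

(** Both sides depend only on the orbits of x and y, so x and y may be taken on
    the preferred side, where [supermodular_sort] applies. If x or y is on the
    mirror, the two kernel values coincide and nothing changes. *)
Lemma quad_polarize_le u v : (forall x, 0 <= u x) -> (forall x, 0 <= v x) ->
  forall p, quad u v p <= quad (polarize u) (polarize v) p.
Proof.
have [sgK near_sg sg_fix] := refl.
move=> u0 v0 [x y].
wlog nx : x / near x \/ sg x = x.
  move=> H; have [nx|nx] := boolP (near x); first by apply: H; left.
  have [nsx|nsx] := boolP (near (sg x)).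
    by rewrite -quad_sgl -[leRHS]quad_sgl; apply: H; left.
  by apply: H; right; apply: sg_fix.
wlog ny : y / near y \/ sg y = y.
  move=> H; have [ny|ny] := boolP (near y); first by apply: H; left.
  have [nsy|nsy] := boolP (near (sg y)).
    by rewrite -quad_sgr -[leRHS]quad_sgr; apply: H; left.
  by apply: H; right; apply: sg_fix.
case: nx => nx; last first.
  have Pux : polarize u x = u x by case: (polarize_pair u x) => -[]; rewrite nx.
  rewrite /quad /= !nx -K_sgl nx Pux.
  by case: (polarize_pair v y) => -[-> ->] //; rewrite le_eqVlt;
    apply/orP; left; apply/eqP; ring.
case: ny => ny; last first.
  have Pvy : polarize v y = v y by case: (polarize_pair v y) => -[]; rewrite ny.
  rewrite /quad /= !ny Pvy.
  by case: (polarize_pair u x) => -[-> ->] //; rewrite le_eqVlt;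
    apply/orP; left; apply/eqP; ring.
rewrite /quad /=.
have [-> ->] := polarize_near u nx; have [-> ->] := polarize_near v ny.
by apply: supermodular_sort => //; apply: Kfold.
Qed.

Lemma quad_polarize_lt u v x y :
  (forall x, 0 <= u x) -> (forall x, 0 <= v x) ->
  strictly_supermodular G -> polarize u = u -> near x -> near y ->
  u (sg x) < u x -> v y < v (sg y) -> K x (sg y) < K x y ->
  quad u v (x, y) < quad u (polarize v) (x, y).
Proof.
move=> u0 v0 [_ Gstrict] Pu nx ny ux vy Kxy.
rewrite /quad /=; have [-> ->] := polarize_near v ny.
rewrite (max_idPr (ltW vy)) (min_idPl (ltW vy)).
have := @Gstrict (u (sg x)) (v y) (u x - u (sg x)) (v (sg y) - v y).
rewrite !subr_gt0 ![_ + (_ - _)]addrC !subrK => /(_ (u0 _) (v0 _) ux vy).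
nra.
Qed.

(** Each of the four reflected families of terms runs through all pairs. *)
Lemma esum_quad u v : (forall x, 0 <= u x) -> (forall x, 0 <= v x) ->
  \esum_(p in [set: T * T]) (quad u v p)%:E =
    (pair_sum u v + pair_sum u v + (pair_sum u v + pair_sum u v))%E.
Proof.
have [sgK _ _] := refl.
move=> u0 v0; pose F p := (G (u p.1) (v p.2) * K p.1 p.2)%:E.
have F0 p : (0 <= F p)%E by rewrite lee_fin mulr_ge0 ?K0 // hG.
have reindex (h : T * T -> T * T) : involutive h ->
    \esum_(p in [set: T * T]) F (h p) = pair_sum u v.
  move=> hK; rewrite /pair_sum [RHS](@reindex_esum _ _ _ setT setT h) //.
  split; [by [] | by move=> p p' _ _ /(can_inj hK)|].
  by move=> p _; exists (h p); rewrite ?hK.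
pose hl (p : T * T) := (sg p.1, p.2); pose hr (p : T * T) := (p.1, sg p.2).
pose hb (p : T * T) := (sg p.1, sg p.2).
rewrite -{1}(reindex id) // -{1}(reindex hb); last by case=> ? ?; rewrite /hb /= !sgK.
rewrite -{1}(reindex hl); last by case=> ? ?; rewrite /hl /= !sgK.
rewrite -{1}(reindex hr); last by case=> ? ?; rewrite /hr /= !sgK.
rewrite -!esumD //; do ?by move=> p _; rewrite adde_ge0.
apply: eq_esum => -[x y] _; rewrite /quad /F /= Ksg K_sgl -!EFinD.
congr EFin; ring.
Qed.

Lemma pair_sum_polarize_le u v : (forall x, 0 <= u x) -> (forall x, 0 <= v x) ->
  (pair_sum u v <= pair_sum (polarize u) (polarize v))%E.
Proof.
move=> u0 v0; have Pu0 := polarize_ge0 u0; have Pv0 := polarize_ge0 v0.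
have : (\esum_(p in [set: T * T]) (quad u v p)%:E <=
  \esum_(p in [set: T * T]) (quad (polarize u) (polarize v) p)%:E)%E.
  by apply: le_esum => p _; rewrite lee_fin quad_polarize_le.
rewrite !esum_quad //.
case: (pair_sum u v) => [a| |]; case: (pair_sum _ _) => [b| |] //=;
  rewrite ?leey ?leNye // !lee_fin; lra.
Qed.

Lemma pair_sum_polarize_lt u v x y :
  (forall x, 0 <= u x) -> (forall x, 0 <= v x) ->
  strictly_supermodular G -> polarize u = u -> near x -> near y ->
  u (sg x) < u x -> v y < v (sg y) -> K x (sg y) < K x y ->
  (pair_sum u (polarize v) < +oo)%E ->
  (pair_sum u v < pair_sum u (polarize v))%E.
Proof.
move=> u0 v0 Gs Pu nx ny ux vy Kxy fin; have Pv0 := polarize_ge0 v0.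
have : (\esum_(p in [set: T * T]) (quad u v p)%:E <
  \esum_(p in [set: T * T]) (quad u (polarize v) p)%:E)%E.
  apply: (@esum_lt _ _ _ _ (x, y)).
  - exact: quad_ge0.
  - by move=> p; rewrite -{2}Pu quad_polarize_le.
  - exact: quad_polarize_lt.
  - rewrite esum_quad //; move: fin; case: (pair_sum _ _) => [b| |] // _.
    by rewrite -!EFinD ltry.
rewrite !esum_quad // {fin}.
case: (pair_sum u v) => [a| |]; case: (pair_sum _ _) => [b| |] //=;
  rewrite ?ltry ?ltNyr // !lte_fin; lra.
Qed.

End Polarization.

(** * The n-th largest value *)

(** The level sets of the n-th largest value are expressed through this
    predicate, which replaces the supremum of minima by finite lists. *)
Definition many (R : realType) (T : choiceType) (D : set T) (u : T -> R)
    (t : R) (n : nat) : Prop :=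
  exists s : seq T, [/\ uniq s, size s = n
    & forall x, x \in s -> D x /\ t < u x].

Section NthLargest.
Variables (R : realType) (T : choiceType).
Implicit Types (D : set T) (u : T -> R).

Lemma admissible_bounded u : admissible u -> exists M, forall x, u x <= M.
Proof.
move=> [u0 ufin]; have [s us] := (finite_seqP _).1 (ufin 1 ltr01).
have [M hM] : exists M, 1 <= M /\ forall x, x \in s -> u x <= M.
  elim: s {us} => [|a s [M [M1 hM]]]; first by exists 1.
  exists (Num.max (u a) M); split; first by rewrite le_max M1 orbT.
  by move=> x; rewrite inE le_max => /predU1P[->|/hM ->]; rewrite ?lexx ?orbT.
exists M => x; have [ux|ux] := lerP (u x) 1; first by apply: le_trans hM.1.
by apply: hM.2; have : [set x | 1 < u x] x by []; rewrite us.
Qed.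

Lemma card_II_seq (A : set T) n : (A #= `I_n)%card ->
  exists s, [/\ uniq s, size s = n & A = [set` s]].
Proof.
move=> An; have finA : finite_set A by apply/finite_setP; exists n.
exists (fset_set A); split; first exact: fset_uniq.
  exact: (card_fset_set An).
by rewrite -[LHS]fset_setK //; apply/seteqP; split => x.
Qed.

Lemma seq_card_II (s : seq T) : uniq s -> ([set` s] #= `I_(size s))%card.
Proof.
move=> us.
have -> : [set` s] = [set` [fset x in s]%fset].
  by apply/seteqP; split => x /=; rewrite inE.
by apply/card_eq_fsetP; rewrite card_fseq undup_id.
Qed.

Lemma nth_largest_ge0 D u n : (forall x, 0 <= u x) -> 0 <= nth_largest D u n.
Proof.
move=> u0; have [S0|S0] := pselect (has_sup
  [set inf (u @` A) | A in [set A : set T | A `<=` D /\ (A #= `I_n)%card]]);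
  last by rewrite /nth_largest sup_out.
have [[r Sr] ub] := S0.
apply: (@le_trans _ _ r); last exact: ub_le_sup ub _ Sr.
case: Sr => A _ <-; have [[x Ax]|/nonemptyPn ->] := pselect (u @` A !=set0);
  last by rewrite inf0.
by apply: lb_le_inf; [exists x|move=> _ [y _ <-]].
Qed.

(** The infimum over a finite set is attained, hence exceeds t when all the
    values do. The restriction t >= 0 covers the case where no set of n points
    exists and the supremum takes its default value 0. *)
Lemma nth_largest_gt D u n t : admissible u -> 0 <= t -> (0 < n)%N ->
  t < nth_largest D u n <-> many D u t n.
Proof.
move=> adm t0 n0; have [M uM] := admissible_bounded adm; have [u0 _] := adm.
have inf_le_val (A : set T) x : A x -> inf (u @` A) <= u x.
  move=> Ax; apply: ge_inf; last by exists x.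
  by exists 0 => _ [y _ <-].
split.
  move=> tS.
  have S0 : [set inf (u @` A) | A in
      [set A : set T | A `<=` D /\ (A #= `I_n)%card]] !=set0.
    apply: contrapT => /nonemptyPn S0.
    by move: tS; rewrite /nth_largest S0 sup0 ltNge t0.
  have [_ [A [AD /card_II_seq[s [us sz As]]] <-] tA] := sup_gt S0 tS.
  exists s; split => // x xs; have Ax : A x by rewrite As.
  by split; [apply: AD | apply: lt_le_trans (inf_le_val _ _ Ax)].
case=> s [us sz hs].
have [m [tm hm]] : exists m, t < m /\ forall x, x \in s -> m <= u x.
  elim: s {us sz} hs => [|a s IH] hs; first by exists (t + 1); rewrite ltrDl.
  have [x xs|m [tm hm]] := IH; first by apply: hs; rewrite inE xs orbT.
  exists (Num.min (u a) m); split.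
    by rewrite lt_min tm andbT; apply: (hs a _).2; rewrite mem_head.
  by move=> x; rewrite inE ge_min => /predU1P[->|/hm ->]; rewrite ?lexx ?orbT.
have [a as_] : exists a, a \in s.
  by case: s sz {us hs hm} n0 => [<- //|a s _ _]; exists a; rewrite mem_head.
apply: lt_le_trans tm _; apply: (@le_trans _ _ (inf (u @` [set` s]))).
  by apply: lb_le_inf; [exists (u a), a|move=> _ [x xs <-]; apply: hm].
apply: ub_le_sup.
  exists M => _ [A [_ /card_II_seq[s' [_ sz' ->]]] <-].
  case: s' sz' => [z|b s' _]; first by rewrite -z in n0.
  by apply: le_trans (inf_le_val _ b _) (uM b); rewrite /= mem_head.
exists [set` s] => //; split; first by move=> x /hs[].
by rewrite -sz; apply: seq_card_II.
Qed.

Lemma many_le D u t m n : (m <= n)%N -> many D u t n -> many D u t m.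
Proof.
move=> mn [s [us sz hs]]; exists (take m s); split.
- exact: take_uniq.
- by rewrite size_take sz; case: ltngtP mn.
- by move=> x /mem_take; apply: hs.
Qed.

Lemma many_perm D u t n (pi : T -> T) : involutive pi ->
  (forall x, D (pi x) <-> D x) -> many D (u \o pi) t n <-> many D u t n.
Proof.
move=> piK Dpi; have inj := inv_inj piK.
suff H w : many D w t n -> many D (w \o pi) t n.
  by split; [|exact: H]; move=> /H; rewrite (_ : (u \o pi) \o pi = u) //;
    apply/funext => x /=; rewrite piK.
case=> s [us sz hs]; exists (map pi s); split.
- by rewrite map_inj_uniq.
- by rewrite size_map.
- by move=> _ /mapP[x xs ->] /=; rewrite piK; have [/Dpi ? ?] := hs x xs.
Qed.

End NthLargest.

Lemma gt_ext (R : realType) (T : Type) (f g : T -> R) :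
  (forall x, 0 <= f x) -> (forall x, 0 <= g x) ->
  (forall t x, 0 <= t -> t < f x <-> t < g x) -> f = g.
Proof.
move=> f0 g0 fg; apply/funext => x; apply/eqP; rewrite eq_le !leNgt.
apply/andP; split; apply/negP.
  by move=> /(fg _ _ (g0 x)); rewrite ltxx.
by move=> /(fg _ _ (f0 x)); rewrite ltxx.
Qed.

(** * Truncation and one-step rearrangement *)

Lemma finite_gt_perm (R : realType) (T : Type) (u : T -> R) (pi : T -> T) t :
  involutive pi -> finite_set [set x | t < u x] ->
  finite_set [set x | t < u (pi x)].
Proof.
move=> piK ufin; have -> : [set x | t < u (pi x)] = pi @` [set x | t < u x].
  apply/seteqP; split=> [x /= tux|_ [x /= tux <-] /=]; last by rewrite piK.
  by exists (pi x); rewrite ?piK.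
exact: finite_image.
Qed.

Lemma admissible_perm (R : realType) (T : Type) (u : T -> R) (pi : T -> T) :
  involutive pi -> admissible u -> admissible (u \o pi).
Proof.
move=> piK [u0 ufin]; split=> [x|t t0]; first exact: u0.
exact/(finite_gt_perm piK)/ufin.
Qed.

(** Values above t are kept as they are, not lowered by t, so that u is
    recovered exactly wherever it is positive once t is small. *)
Definition truncate (R : realType) (T : Type) (t : R) (u : T -> R) (x : T) : R :=
  if t < u x then u x else 0.

Section Truncate.
Variables (R : realType) (T : choiceType).
Implicit Types u w : T -> R.

Lemma truncate_ge0 t u : (forall x, 0 <= u x) -> forall x, 0 <= truncate t u x.
Proof. by move=> u0 x; rewrite /truncate; case: ifP. Qed.

(** The level sets of a truncation are level sets of u; hence truncation
    commutes with every operation described by level sets. *)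
Lemma lt_truncate s t u x : 0 <= s ->
  (s < truncate t u x) = (Num.max s t < u x).
Proof.
move=> s0; rewrite /truncate gt_max; case: ifP => _; rewrite ?andbT ?andbF //.
by rewrite ltNge s0.
Qed.

Lemma many_truncate D s t u n : 0 <= s ->
  many D (truncate t u) s n <-> many D u (Num.max s t) n.
Proof.
by move=> s0; split=> -[l [ul sz hl]]; exists l; split => // x /hl[Dx];
  rewrite lt_truncate.
Qed.

Lemma admissible_truncate t u : admissible u -> admissible (truncate t u).
Proof.
move=> [u0 ufin]; split; first exact: truncate_ge0.
move=> s s0; apply: sub_finite_set (ufin s s0) => x /=.
by rewrite lt_truncate ?ltW // gt_max => /andP[].
Qed.

Lemma truncate_inj u w : (forall x, 0 <= u x) -> (forall x, 0 <= w x) ->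
  (forall t, 0 < t -> truncate t u = truncate t w) -> u = w.
Proof.
move=> u0 w0 uw; apply: gt_ext => // t x t0.
suff H f g : (forall x, 0 <= f x) ->
    (forall t, 0 < t -> truncate t f = truncate t g) -> t < f x -> t < g x.
  by split; apply: H => // s s0; rewrite uw.
move=> f0 fg tf; have fx0 : 0 < f x / 2 by apply: divr_gt0 => //; lra.
have := congr1 (fun h => h x) (fg _ fx0); rewrite /truncate.
rewrite ifT; last by lra.
by case: ifP => [_ <- //|_ fx]; move: tf; rewrite fx; lra.
Qed.

End Truncate.

(** The place of the point in the order 0, 1, -1, 2, -2, ... of its line
    (or 1/2, -1/2, 3/2, ...), counted from 1. *)
Definition rank (d : nat) (q : lattice d -> int) (x : lattice d) : nat :=
  if q x <= 0 then (absz (q x)).+1 else absz (q x).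

Section AxisTheory.
Variables (d : nat) (e : 'rV[rat]_d) (f : lattice d) (q : lattice d -> int).
Hypothesis ax : axis e f q.
Local Notation sg := (reflect_axis f q).
Local Notation near := (near_side q).

Lemma class_refl x : parallel_class e x x.
Proof. by apply/(axis_class ax); exists 0; rewrite scale0r addr0. Qed.

Lemma class_trans x y z :
  parallel_class e x y -> parallel_class e y z -> parallel_class e x z.
Proof.
move=> /(axis_class ax)[m ->] /(axis_class ax)[n ->].
by apply/(axis_class ax); exists (m + n); rewrite scalerDl addrA.
Qed.

Lemma class_sym x y : parallel_class e x y -> parallel_class e y x.
Proof.
move=> /(axis_class ax)[m ->]; apply/(axis_class ax); exists (- m).
by rewrite scaleNr addrK.
Qed.

Lemma class_eq x y : parallel_class e x y ->
  parallel_class e x = parallel_class e y.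
Proof.
move=> xy; apply/seteqP; split => z; last exact: class_trans.
by apply: class_trans; apply: class_sym.
Qed.

Lemma class_reflect c x : parallel_class e x (sg c x).
Proof. by apply/(axis_class ax); exists (c%:Z - q x). Qed.

Lemma axis_reflect c x : q (sg c x) = 2 * c%:Z - q x.
Proof. rewrite (axis_shift ax); lia. Qed.

Lemma axis_reflection c : reflection (sg c) (near c).
Proof.
split=> [x|x|x].
- rewrite {1}/reflect_axis axis_reflect {1}/reflect_axis -addrA -scalerDl.
  have -> : c%:Z - q x + (c%:Z - (2 * c%:Z - q x)) = 0 by lia.
  by rewrite scale0r addr0.
- by rewrite /near_side axis_reflect; case: c; lia.
- rewrite /near_side axis_reflect /reflect_axis => nx nsx.
  by rewrite (_ : _ - _ = 0) ?scale0r ?addr0 //; case: c nx nsx; lia.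
Qed.

Lemma rank_gt0 x : (0 < rank q x)%N.
Proof. rewrite /rank; case: ifP; lia. Qed.

Lemma rank_inj x y : parallel_class e x y -> rank q x = rank q y -> x = y.
Proof.
move=> /(axis_class ax)[m ->]; rewrite /rank (axis_shift ax) => rxy.
have -> : m = 0 by move: rxy; case: ifP; case: ifP; lia.
by rewrite scale0r addr0.
Qed.

Lemma rank_near c x : near c x -> (rank q x < rank q (sg c x))%N.
Proof.
rewrite /rank axis_reflect /near_side; case: c; case: ifP; case: ifP; lia.
Qed.

(** The two reflections link neighbours in the order: positions s and 1 - s
    when s > 0, positions s and -s when s < 0. *)
Lemma rank_pred x : (1 < rank q x)%N -> exists c,
  near c (sg c x) /\ (rank q x = (rank q (sg c x)).+1)%N.
Proof.
move=> rx; exists (0 < q x); move: rx; rewrite /near_side /rank axis_reflect.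
by case: (ltP 0 (q x)) => qx /=; case: ifP; lia.
Qed.

Variable R : realType.
Implicit Types u w : lattice d -> R.

Lemma rearrange_step_rank u x :
  rearrange_step e u x = nth_largest (parallel_class e x) u (rank q x).
Proof.
rewrite /rearrange_step /rearrange_Z (axis_inner ax) /rank.
have -> : ((q x)%:~R / 2 <= 0 :> rat) = (q x <= 0).
  by rewrite pmulr_lle0 ?invr_gt0 // lerz0.
have -> : 2 * ((q x)%:~R / 2) = (q x)%:~R :> rat by field.
case: ifP => qx; congr nth_largest.
  rewrite (_ : 1 - (q x)%:~R = (absz (q x)).+1%:R) ?natrK //.
  rewrite -[(_.+1)%:R]/(((absz (q x)).+1%:Z)%:~R) -[1]/(1%:~R) -rmorphB /=.
  by congr (_%:~R); lia.
rewrite (_ : (q x)%:~R = (absz (q x))%:R) ?natrK //.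
by rewrite -[(absz _)%:R]/((absz (q x))%:Z%:~R); congr (_%:~R); lia.
Qed.

Lemma rearrange_step_gt u t x : admissible u -> 0 <= t ->
  t < rearrange_step e u x <-> many (parallel_class e x) u t (rank q x).
Proof.
by move=> adm t0; rewrite rearrange_step_rank nth_largest_gt // rank_gt0.
Qed.

Lemma rearrange_step_ge0 u : (forall x, 0 <= u x) ->
  forall x, 0 <= rearrange_step e u x.
Proof. by move=> u0 x; rewrite rearrange_step_rank nth_largest_ge0. Qed.

Lemma rearrange_step_mono u x y : admissible u -> parallel_class e x y ->
  (rank q x <= rank q y)%N -> rearrange_step e u y <= rearrange_step e u x.
Proof.
move=> adm xy rxy; rewrite leNgt; apply/negP => lt_xy.
have t0 := rearrange_step_ge0 adm.1 x.
suff : rearrange_step e u x < rearrange_step e u x by rewrite ltxx.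
apply/(rearrange_step_gt _ adm t0); apply: many_le rxy _.
by rewrite (class_eq xy); apply/(rearrange_step_gt _ adm t0).
Qed.

Lemma rearrange_step_truncate u t : admissible u -> 0 <= t ->
  rearrange_step e (truncate t u) = truncate t (rearrange_step e u).
Proof.
move=> adm t0; have admt := admissible_truncate t adm.
apply: gt_ext.
- exact/rearrange_step_ge0/truncate_ge0/adm.1.
- exact/truncate_ge0/rearrange_step_ge0/adm.1.
move=> s x s0; rewrite lt_truncate // rearrange_step_gt // many_truncate //.
by rewrite rearrange_step_gt // le_max s0.
Qed.

(** The reflection stays on each line, so the number of values above any level
    on the line is unchanged. *)
Lemma rearrange_step_polarize c u : admissible u ->
  rearrange_step e (polarize (sg c) (near c) u) = rearrange_step e u.
Proof.
move=> adm; have [pi [piK pi_or ->]] := polarize_perm (axis_reflection c) u.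
have admp := admissible_perm piK adm.
apply: gt_ext => [||t x t0].
- exact/rearrange_step_ge0/admp.1.
- exact/rearrange_step_ge0/adm.1.
rewrite !rearrange_step_gt // many_perm // => y.
have ypi : parallel_class e y (pi y).
  by case: (pi_or y) => ->; [exact: class_refl|exact: class_reflect].
by split=> h; apply: class_trans h _ => //; apply: class_sym.
Qed.

(** By [rank_pred], a function fixed by both polarizations is decreasing along
    the order of each line; such a function exceeds t at x exactly when it does
    so on at least [rank q x] points of the line. *)
Section Fixed.
Variable w : lattice d -> R.
Hypotheses (adm : admissible w)
  (wP : forall c, polarize (sg c) (near c) w = w).

Let w_near c x : near c x -> w (sg c x) <= w x.
Proof.
move=> nx; rewrite -{2}(wP c) /polarize nx le_max lexx orbT //.
Qed.

Let w_rank x y : parallel_class e x y -> (rank q x <= rank q y)%N -> w y <= w x.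
Proof.
move En : (rank q y) => n; elim: n y En => [|n IH] y En xy.
  by rewrite leqn0 => rx; have := rank_gt0 x; rewrite (eqP rx).
rewrite leq_eqVlt => /predU1P[rx|rx].
  by rewrite (@rank_inj x y) // En.
have ry1 : (1 < rank q y)%N by have := rank_gt0 x; rewrite En; lia.
have [c [nc rc]] := rank_pred ry1.
have sgK := reflectionK (axis_reflection c).
apply: (@le_trans _ _ (w (sg c y))).
  by rewrite -{1}(sgK y); apply: w_near.
apply: IH => //; first by lia.
exact: class_trans xy (class_reflect _ _).
Qed.

Let segment x : exists s, [/\ uniq s, size s = rank q x
  & forall y, y \in s -> parallel_class e x y /\ (rank q y <= rank q x)%N].
Proof.
move En : (rank q x) => n; elim: n x En => [|n IH] x En.
  by have := rank_gt0 x; rewrite En.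
have [n0|n0] := posnP n.
  exists [:: x]; split; rewrite ?n0 //= => y; rewrite inE => /eqP ->.
  by split; [exact: class_refl|rewrite En n0].
have [c [nc rc]] : exists c, near c (sg c x) /\ rank q x = (rank q (sg c x)).+1.
  by apply: rank_pred; rewrite En; lia.
have [|s [us sz hs]] := IH (sg c x); first by lia.
exists (x :: s); split.
- rewrite /= us andbT; apply/negP => /hs[_]; lia.
- by rewrite /= sz.
- move=> y; rewrite inE => /predU1P[->|/hs[xy ry]].
    by split; [exact: class_refl|rewrite En].
  by split; [exact: class_trans (class_reflect c x) xy|lia].
Qed.

Lemma rearrange_step_fixed : rearrange_step e w = w.
Proof.
apply: gt_ext => [||t x t0].
- exact/rearrange_step_ge0/adm.1.
- exact: adm.1.
rewrite rearrange_step_gt //; split=> [[s [us sz hs]]|tx].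
  have [y ys ry] : exists2 y, y \in s & (rank q x <= rank q y)%N.
    apply/hasP; apply: contraT => /hasPn small.
    have : (size (map (rank q) s) <= size (iota 1 (rank q x).-1))%N.
      apply: uniq_leq_size.
        rewrite map_inj_in_uniq // => y z ys zs; apply: rank_inj.
        by apply: class_trans (class_sym (hs y ys).1) (hs z zs).1.
      move=> _ /mapP[y ys ->]; rewrite mem_iota rank_gt0 /=.
      by move: (small y ys); have := rank_gt0 x; lia.
    by rewrite size_map size_iota sz; have := rank_gt0 x; lia.
  by apply: lt_le_trans (hs y ys).2 _; apply: w_rank ry; apply: (hs y ys).1.
have [s [us sz hs]] := segment x; exists s; split => // y ys.
have [xy ryx] := hs y ys; split => //.
by apply: lt_le_trans tx _; apply: w_rank ryx; apply: class_sym.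
Qed.

End Fixed.
End AxisTheory.

(** * An energy lowered by polarization *)

Section Energy.
Variables (R : realType) (T : choiceType) (W : T -> nat).
Implicit Types (r : R -> nat) (w : T -> R).

(** The map r turns the values of w into natural numbers, so that a strictly
    decreasing sequence of energies is finite. The sum is taken in the extended
    reals to share the comparison of sums used for the Riesz sums. *)
Definition energy r w : \bar R :=
  \esum_(x in [set: T]) ((r (w x) * W x)%N%:R)%:E.

(** All functions reached from w by permuting its values satisfy this for the
    same r, which makes their energies comparable. *)
Record ranked r w : Prop := Ranked {
  ranked_ge0 : forall x, 0 <= w x;
  ranked_fin : finite_set [set x | 0 < w x];
  ranked_0 : r 0 = 0%N;
  ranked_lt : forall x y, w x < w y -> (r (w x) < r (w y))%N
}.

Lemma ranked_admissible r w : ranked r w -> admissible w.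
Proof.
case=> w0 wfin _ _; split=> // t t0; apply: sub_finite_set wfin => x /=.
exact: lt_trans.
Qed.

(** Take for r t the number of support points whose value is at most t. *)
Lemma ranked_exists w : (forall x, 0 <= w x) -> finite_set [set x | 0 < w x] ->
  exists r, ranked r w.
Proof.
move=> w0 wfin; have [s ws] := (finite_seqP _).1 wfin.
exists (fun t => count (fun x => w x <= t) s); split => //.
  apply/eqP; rewrite -leqn0 leqNgt -has_count; apply/negP => /hasP[x xs].
  by have : [set` s] x by []; rewrite -ws /= ltNge => /negbTE ->.
move=> x y wxy; have /= : [set` s] y.
  by rewrite -ws /=; apply: le_lt_trans wxy; apply: w0.
elim: s {ws} => // a s IH; rewrite inE => /predU1P[<-|/IH lt_s] /=.
  rewrite lexx leNgt wxy /= add0n add1n ltnS.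
  by apply: sub_count => z /= zx; apply: le_trans zx (ltW wxy).
apply: leq_trans (leq_add (leqnn _) lt_s); rewrite addnS ltnS leq_add2r.
by case: (lerP (w a) (w x)) => // ax; rewrite (le_trans ax (ltW wxy)).
Qed.

Lemma ranked_perm r w (pi : T -> T) :
  involutive pi -> ranked r w -> ranked r (w \o pi).
Proof.
move=> piK [w0 wfin r0 rlt]; split=> //= [|x y]; last exact: rlt.
exact: (finite_gt_perm piK wfin).
Qed.

Lemma energy_nat r w : ranked r w -> exists n : nat, energy r w = n%:R%:E.
Proof.
case=> w0 wfin r0 _; rewrite /energy.
have -> : \esum_(x in [set: T]) ((r (w x) * W x)%N%:R)%:E =
    \esum_(x in [set x | 0 < w x]) ((r (w x) * W x)%N%:R)%:E :> \bar R.
  rewrite [RHS]esum_mkcond; apply: eq_esum => x _; case: ifPn => //.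
  rewrite notin_setE /= => /negP; rewrite -leNgt => wx.
  by rewrite (_ : w x = 0) ?r0 ?mul0n //; apply/eqP; rewrite eq_le wx w0.
rewrite esum_fset // fsbig_finite //= sumEFin -natr_sum.
by eexists.
Qed.

Variables (sg : T -> T) (near : pred T).
Hypothesis refl : reflection sg near.
Hypothesis W_near : forall x, near x -> (W x < W (sg x))%N.

(** The gain of a polarization is visible on one orbit: exchanging w x < w (sg x)
    with W x < W (sg x) changes the energy by the product of two differences. *)
Let orbit_energy r w (x : T) : nat := (r (w x) * W x + r (w (sg x)) * W (sg x))%N.

Let orbit_energy_sg r w x : orbit_energy r w (sg x) = orbit_energy r w x.
Proof. by rewrite /orbit_energy (reflectionK refl) addnC. Qed.

Let orbit_energy_polarize r w x : ranked r w ->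
  (orbit_energy r (polarize sg near w) x <= orbit_energy r w x)%N /\
  ((polarize sg near w x != w x) || (polarize sg near w (sg x) != w (sg x)) ->
   (orbit_energy r (polarize sg near w) x < orbit_energy r w x)%N).
Proof.
have [sgK near_sg sg_fix] := refl.
case=> w0 wfin r0 rlt.
wlog nx : x / near x \/ sg x = x.
  move=> H; have [nx|nx] := boolP (near x); first by apply: H; left.
  have [nsx|nsx] := boolP (near (sg x)).
    by have := H (sg x) (or_introl nsx); rewrite !orbit_energy_sg sgK orbC.
  by apply: H; right; apply: sg_fix.
case: nx => nx; last first.
  have Pw : polarize sg near w x = w x.
    by case: (polarize_pair refl w x) => -[]; rewrite nx.
  by rewrite /orbit_energy nx Pw eqxx.
rewrite /orbit_energy; have [-> ->] := polarize_near refl w nx.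
case: (ltP (w x) (w (sg x))) => wx; last by rewrite !eqxx.
have := rlt _ _ wx; have := W_near nx; split; nia.
Qed.

Let esum_orbit_energy r w : ranked r w ->
  \esum_(x in [set: T]) ((orbit_energy r w x)%:R)%:E = (energy r w + energy r w)%E :> \bar R.
Proof.
have [sgK _ _] := refl => rw.
have {2}-> : energy r w =
    \esum_(x in [set: T]) ((r (w (sg x)) * W (sg x))%N%:R)%:E.
  rewrite /energy (@reindex_esum _ _ _ setT setT sg) //.
  split; [by []| by move=> p p' _ _ /(can_inj sgK)|].
  by move=> p _; exists (sg p); rewrite ?sgK.
rewrite /energy -esumD => [|x _|x _]; rewrite ?lee_fin ?ler0n //.
by apply: eq_esum => x _; rewrite -EFinD -natrD.
Qed.

Lemma ranked_polarize r w : ranked r w -> ranked r (polarize sg near w).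
Proof.
by have [pi [piK _ ->]] := polarize_perm refl w; apply: ranked_perm.
Qed.

Lemma energy_polarize r w : ranked r w -> polarize sg near w = w \/
  (energy r (polarize sg near w) < energy r w)%E.
Proof.
move=> rw; have rPw := ranked_polarize rw.
have [->|/eqP neq] := eqVneq (polarize sg near w) w; [by left|right].
have [x Px] : exists x, polarize sg near w x != w x.
  by apply: contrapT => H; apply: neq; apply/funext => x; apply/eqP;
    apply: contrapT => /negP Px; apply: H; exists x.
have := @esum_lt R T (fun x => (orbit_energy r (polarize sg near w) x)%:R)
  (fun x => (orbit_energy r w x)%:R) x.
rewrite !esum_orbit_energy //; have [m ->] := energy_nat rPw; have [n ->] := energy_nat rw.
rewrite -!EFinD ltry !lte_fin -!natrD !ltr_nat => lt_mn.
suff : (m + m < n + n)%N by lia.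
apply: lt_mn => //.
- by move=> y; rewrite ler_nat; apply: (orbit_energy_polarize y rw).1.
- by apply: (orbit_energy_polarize x rw).2; rewrite Px.
Qed.

End Energy.

(** Well-foundedness of nat, for a sequence in which a step may also do
    nothing. *)
Lemma descent_stabilizes (R : realType) (X : Type) (E : X -> \bar R) (x : nat -> X) :
  (forall k, exists n : nat, E (x k) = n%:R%:E) ->
  (forall k, x k.+1 = x k \/ (E (x k.+1) < E (x k))%E) ->
  exists K, forall k, (K <= k)%N -> x k = x K.
Proof.
move=> Enat Edecr.
have Elt k j : (k <= j)%N -> x j = x k \/ (E (x j) < E (x k))%E.
  elim: j => [|j IH]; first by rewrite leqn0 => /eqP ->; left.
  rewrite leq_eqVlt => /predU1P[->|]; first by left.
  rewrite ltnS => /IH[<-|lt_jk]; first exact: Edecr.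
  by right; case: (Edecr j) => [-> //|lt_j]; apply: lt_trans lt_j lt_jk.
suff H n : forall k, E (x k) = n%:R%:E ->
    exists K, forall j, (K <= j)%N -> x j = x K.
  by have [n En] := Enat 0%N; apply: H En.
elim/ltn_ind: n => n IH k Ek.
have [cst|/existsNP[j /not_implyP[kj xj]]] :=
  pselect (forall j, (k <= j)%N -> x j = x k); first by exists k.
have [m Ej] := Enat j; apply: (IH m _ j Ej).
by case: (Elt k j kj) => //; rewrite Ek Ej lte_fin ltr_nat.
Qed.

(** * One-step rearrangement as an iterated polarization *)

Lemma truncate_ranked (R : realType) (T : choiceType) (u : T -> R) t :
  admissible u -> 0 < t -> exists r, ranked r (truncate t u).
Proof.
move=> adm t0; apply: ranked_exists; first exact/truncate_ge0/adm.1.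
apply: sub_finite_set (adm.2 t t0) => x /=.
by rewrite lt_truncate // (max_idPr (ltW t0)).
Qed.

Section StepByPolarization.
Variables (R : realType) (d : nat) (e : 'rV[rat]_d) (f : lattice d)
  (q : lattice d -> int).
Hypothesis ax : axis e f q.
Implicit Types (u v w : lattice d -> R) (r : R -> nat).

(** Starting with s -> -s; stationarity over two consecutive steps gives
    invariance under both reflections. *)
Fixpoint alternate (k : nat) (u : lattice d -> R) : lattice d -> R :=
  if k is k'.+1 then
    polarize (reflect_axis f q (odd k')) (near_side q (odd k')) (alternate k' u)
  else u.

Lemma ranked_alternate r u k : ranked r u -> ranked r (alternate k u).
Proof.
by move=> ru; elim: k => //= k IH; apply: ranked_polarize (axis_reflection ax _) _ _ IH.
Qed.

Lemma rearrange_step_alternate r u k : ranked r u ->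
  rearrange_step e (alternate k u) = rearrange_step e u.
Proof.
move=> ru; elim: k => //= k <-; apply: (rearrange_step_polarize ax).
exact/ranked_admissible/ranked_alternate/ru.
Qed.

Lemma energy_alternate r u k : ranked r u ->
  alternate k.+1 u = alternate k u \/
  (energy (@weight d) r (alternate k.+1 u) < energy (@weight d) r (alternate k u))%E.
Proof.
move=> ru; apply: energy_polarize (axis_reflection ax _) _ _ _ _.
  exact: (axis_weight ax).
exact: ranked_alternate.
Qed.

(** The stationary function is fixed by both polarizations, so it is its own
    rearrangement, and that is the rearrangement of u because polarizing does
    not change it. *)
Lemma alternate_stabilizes r u : ranked r u ->
  exists K, forall k, (K <= k)%N -> alternate k u = rearrange_step e u.
Proof.
move=> ru.
have [||K HK] := @descent_stabilizes R _ (energy (@weight d) r) (fun k => alternate k u).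
- by move=> k; apply/energy_nat/ranked_alternate.
- by move=> k; apply: energy_alternate.
exists K => k Kk; rewrite HK // -(rearrange_step_alternate K ru).
apply/esym/(rearrange_step_fixed ax).
  exact/ranked_admissible/ranked_alternate/ru.
have fixedK : polarize (reflect_axis f q (odd K)) (near_side q (odd K))
    (alternate K u) = alternate K u by rewrite -[LHS]/(alternate K.+1 u) HK.
have fixedK1 : polarize (reflect_axis f q (~~ odd K)) (near_side q (~~ odd K))
    (alternate K u) = alternate K u.
  rewrite -{1}(HK K.+1) // -[~~ odd K]/(odd K.+1).
  by rewrite -[LHS]/(alternate K.+2 u) HK // leqW.
by move=> c; move: fixedK fixedK1; case: c; case: (odd K).
Qed.

Lemma ranked_step r u : ranked r u -> ranked r (rearrange_step e u).
Proof.
by move=> ru; have [K HK] := alternate_stabilizes ru; rewrite -(HK K) //;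
  apply: ranked_alternate.
Qed.

Lemma energy_step r u : ranked r u -> rearrange_step e u = u \/
  (energy (@weight d) r (rearrange_step e u) < energy (@weight d) r u)%E.
Proof.
move=> ru; have [K HK] := alternate_stabilizes ru; rewrite -(HK K) //.
elim: K {HK} => [|K [eq_K|lt_K]]; first by left.
  by have := energy_alternate K ru; rewrite eq_K.
have [->|lt_K1] := energy_alternate K ru; first by right.
by right; apply: lt_trans lt_K1 lt_K.
Qed.

(** The points where the rearrangement exceeds t form the support of the
    rearrangement of a truncation, which permutes a finite support. *)
Lemma admissible_step u : admissible u -> admissible (rearrange_step e u).
Proof.
move=> adm; have s0 := rearrange_step_ge0 ax adm.1.
split => // t t0.
have [r /ranked_step/ranked_fin] := truncate_ranked adm t0.
rewrite (rearrange_step_truncate ax adm (ltW t0)).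
apply: sub_finite_set => x /=.
by rewrite lt_truncate // (max_idPr (ltW t0)).
Qed.

Variables (G : R -> R -> R) (H : R -> R).
Hypotheses (hG : maps_Rplus2 G) (Gsuper : supermodular G) (G00 : G 0 0 = 0)
  (hH : maps_Rplus H) (Hdecr : decreasing_Rplus H).

Lemma kernel_ge0 (x y : lattice d) : 0 <= H (graph_dist x y)%:R.
Proof. by apply: hH; rewrite ler0n. Qed.

Lemma kernel_isometry c (x y : lattice d) :
  H (graph_dist (reflect_axis f q c x) (reflect_axis f q c y))%:R =
  H (graph_dist x y)%:R.
Proof. by rewrite (axis_isometry ax). Qed.

Lemma kernel_fold c (x y : lattice d) : near_side q c x -> near_side q c y ->
  H (graph_dist x (reflect_axis f q c y))%:R <= H (graph_dist x y)%:R.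
Proof.
by move=> nx ny; apply: Hdecr; rewrite ?ler0n // ler_nat (axis_fold ax).
Qed.

Lemma riesz_polarize_le c u v : (forall x, 0 <= u x) -> (forall x, 0 <= v x) ->
  (riesz_sum G H u v <=
   riesz_sum G H (polarize (reflect_axis f q c) (near_side q c) u)
                 (polarize (reflect_axis f q c) (near_side q c) v))%E.
Proof.
exact: (pair_sum_polarize_le (axis_reflection ax c) hG Gsuper kernel_ge0
  (kernel_isometry c) (@kernel_fold c)).
Qed.

Lemma riesz_alternate_le r r' u v k : ranked r u -> ranked r' v ->
  (riesz_sum G H u v <= riesz_sum G H (alternate k u) (alternate k v))%E.
Proof.
move=> ru rv; elim: k => [|k IH] //=; apply: le_trans IH _.
apply: riesz_polarize_le.
  exact/ranked_ge0/ranked_alternate/ru.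
exact/ranked_ge0/ranked_alternate/rv.
Qed.

Lemma riesz_step_ranked r r' u v : ranked r u -> ranked r' v ->
  (riesz_sum G H u v <=
   riesz_sum G H (rearrange_step e u) (rearrange_step e v))%E.
Proof.
move=> ru rv; have [Ku HKu] := alternate_stabilizes ru.
have [Kv HKv] := alternate_stabilizes rv.
rewrite -(HKu (maxn Ku Kv)) ?leq_maxl // -(HKv (maxn Ku Kv)) ?leq_maxr //.
exact: riesz_alternate_le ru rv.
Qed.

End StepByPolarization.

(** * Reduction to finite support and the Schwarz rearrangement *)

Section Truncation.
Variables (R : realType) (T : choiceType) (G : R -> R -> R) (K : T -> T -> R).
Hypotheses (hG : maps_Rplus2 G) (Gsuper : supermodular G) (G00 : G 0 0 = 0)
  (K0 : forall x y, 0 <= K x y).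
Implicit Types u v : T -> R.

(** G need not be monotone, since G s 0 is arbitrary; but replacing an
    argument by 0 does not increase G: supermodularity at the origin gives
    G 0 t + G s 0 <= G s t. *)
Lemma supermodular_truncate_le s t (t0 : R) : 0 <= s -> 0 <= t ->
  G (if t0 < s then s else 0) (if t0 < t then t else 0) <= G s t.
Proof.
move=> s0 t1; have := @Gsuper 0 0 s t (lexx _) (lexx _) s0 t1.
rewrite !add0r G00 addr0; have := hG s0 (lexx _); have := hG (lexx _) t1.
by case: ifP => _; case: ifP => _; rewrite ?G00 //; [lra|lra|move=> *; exact: hG].
Qed.

Lemma truncate_small (s : seq T) u : (forall x, 0 <= u x) ->
  exists2 t, 0 < t & forall t' x, t' <= t -> x \in s -> truncate t' u x = u x.
Proof.
move=> u0; elim: s => [|a s [t t0 ht]]; first by exists 1.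
have [ua|ua] := ltrP 0 (u a).
  exists (Num.min t (u a / 2)); first by rewrite lt_min t0 divr_gt0.
  move=> t' x; rewrite le_min inE => /andP[t't t'u] /predU1P[->|]; last exact: ht.
  by rewrite /truncate ifT //; apply: le_lt_trans t'u _; lra.
exists t => // t' x t't; rewrite inE => /predU1P[->|]; last exact: ht.
have ua0 : u a = 0 by apply/eqP; rewrite eq_le ua u0.
by rewrite /truncate ua0; case: ifP.
Qed.

(** On a finite set of pairs u and v agree with their truncations at a small
    enough level. *)
Lemma pair_sum_truncate_le u v u' v' :
  (forall x, 0 <= u x) -> (forall x, 0 <= v x) ->
  (forall x, 0 <= u' x) -> (forall x, 0 <= v' x) ->
  (forall t, 0 < t ->
     (pair_sum G K (truncate t u) (truncate t v) <=
      pair_sum G K (truncate t u') (truncate t v'))%E) ->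
  (pair_sum G K u v <= pair_sum G K u' v')%E.
Proof.
move=> u0 v0 u'0 v'0 le_t; apply: ge_ereal_sup => _ [X [finX _] <-].
have [s Xs] := (finite_seqP _).1 finX.
have [t1 t10 ht1] := truncate_small (map fst s) u0.
have [t2 t20 ht2] := truncate_small (map snd s) v0.
pose t := Num.min t1 t2; have t0 : 0 < t by rewrite lt_min t10.
apply: (@le_trans _ _ (pair_sum G K (truncate t u) (truncate t v))).
  apply: esum_ge; exists X => //; apply: lee_fsum => // p Xp.
  have ps : p \in s by have : [set` s] p by rewrite -Xs.
  by rewrite ht1 ?ge_min ?lexx ?map_f // ht2 ?ge_min ?lexx ?orbT ?map_f.
apply: le_trans (le_t t t0) _; apply: le_esum => p _.
by rewrite lee_fin ler_wpM2r //; apply: supermodular_truncate_le.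
Qed.

End Truncation.

Section Schwarz.
Variables (R : realType) (d : nat) (es : seq 'rV[rat]_d).
Hypotheses (hd : (1 <= d)%N) (hes : enumerates_directions es).
Implicit Types (u v : lattice d -> R).

Lemma directions_gt0 : (0 < size es)%N.
Proof.
have : unit_vec (Ordinal hd) \in es by apply/hes.2; left; exists (Ordinal hd).
by case: es.
Qed.

Lemma nth_direction k : is_direction (nth 0 es (k %% size es)%N).
Proof. by apply/hes.2/mem_nth; rewrite ltn_mod directions_gt0. Qed.

Lemma admissible_iter u k : admissible u -> admissible (rearrange_iter es u k).
Proof.
move=> adm; elim: k => //= k IH.
by have [f [q ax]] := direction_axis (nth_direction k); apply: (admissible_step ax).
Qed.

Lemma rearrange_iter_truncate u k t : admissible u -> 0 <= t ->
  rearrange_iter es (truncate t u) k = truncate t (rearrange_iter es u k).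
Proof.
move=> adm t0; elim: k => //= k ->.
have [f [q ax]] := direction_axis (nth_direction k).
exact/(rearrange_step_truncate ax)/t0/admissible_iter.
Qed.

Lemma ranked_iter r u k : ranked r u -> ranked r (rearrange_iter es u k).
Proof.
move=> ru; elim: k => //= k IH.
by have [f [q ax]] := direction_axis (nth_direction k); apply: (ranked_step ax).
Qed.

Lemma rearrange_iter_stabilizes u t : admissible u -> 0 < t ->
  exists K, forall k, (K <= k)%N ->
    truncate t (rearrange_iter es u k) = truncate t (rearrange_iter es u K).
Proof.
move=> adm t0; have [r ru] := truncate_ranked adm t0.
have [||K HK] := @descent_stabilizes R _ (energy (@weight d) r)
  (rearrange_iter es (truncate t u)).
- by move=> k; apply/energy_nat/ranked_iter.
- move=> k; have [f [q ax]] := direction_axis (nth_direction k).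
  exact: (energy_step ax (ranked_iter k ru)).
by exists K => k Kk; rewrite -!rearrange_iter_truncate ?ltW // HK.
Qed.

(** Either the iterates at x become constant, at a value above some level t at
    which the truncations are stationary, or they are eventually below every
    level. The limit is described in this form because it determines the
    truncations of the limit. *)
Lemma rearrange_iter_lim u x : admissible u ->
  (exists K, forall k, (K <= k)%N -> rearrange_iter es u k x = schwarz es u x)
  \/ schwarz es u x = 0 /\ forall t, 0 < t ->
    exists K, forall k, (K <= k)%N -> rearrange_iter es u k x <= t.
Proof.
move=> adm.
have [[t [t0 [K [HK tx]]]]|small] := pselect (exists t, 0 < t /\ exists K,
    (forall k, (K <= k)%N ->
      truncate t (rearrange_iter es u k) = truncate t (rearrange_iter es u K))
    /\ t < rearrange_iter es u K x).
  left; exists K => k Kk.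
  have cst j : (K <= j)%N -> rearrange_iter es u j x = rearrange_iter es u K x.
    move=> /HK/(congr1 (fun h => h x)); rewrite /truncate tx.
    by case: ifP => // _ h; move: tx; rewrite -h; lra.
  rewrite cst //; apply/esym/cvg_lim => //.
  apply: cvg_near_cst; exists K => // j /= Kj; exact: cst.
have le_t t : 0 < t ->
    exists K, forall k, (K <= k)%N -> rearrange_iter es u k x <= t.
  move=> t0; have [K HK] := rearrange_iter_stabilizes adm t0.
  exists K => k Kk; rewrite leNgt; apply/negP => tx; apply: small.
  exists t; split=> //; exists K; split=> //.
  have /(congr1 (fun h => h x)) := HK k Kk; rewrite /truncate tx.
  by case: ifP => // _ h; move: tx; rewrite h; lra.
right; split => //; apply: cvg_lim => //; apply/cvgrPdist_le => t t0.
have [K HK] := le_t t t0; exists K => // k /= Kk.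
by rewrite sub0r normrN ger0_norm ?HK //; apply: (admissible_iter k adm).1.
Qed.

Lemma schwarz_ge0 u x : admissible u -> 0 <= schwarz es u x.
Proof.
move=> adm; have [[K /(_ K (leqnn K)) <-]|[-> //]] := rearrange_iter_lim x adm.
exact: (admissible_iter K adm).1.
Qed.

Lemma schwarz_truncate u t : admissible u -> 0 < t -> exists K,
  forall k, (K <= k)%N -> rearrange_iter es (truncate t u) k =
    truncate t (schwarz es u).
Proof.
move=> adm t0; have [K HK] := rearrange_iter_stabilizes adm t0.
exists K => k Kk; rewrite rearrange_iter_truncate ?ltW // HK //.
apply/funext => x; have [[N HN]|[s0 HN]] := rearrange_iter_lim x adm.
  by rewrite -(HK (maxn K N)) ?leq_maxl // /truncate HN // leq_maxr.
have [N {}HN] := HN t t0.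
rewrite -(HK (maxn K N)) ?leq_maxl // /truncate s0 ltNge HN ?leq_maxr //=.
by case: ifP.
Qed.

Lemma admissible_schwarz u : admissible u -> admissible (schwarz es u).
Proof.
move=> adm; split=> [x|t t0]; first exact: schwarz_ge0.
have [K /(_ K (leqnn K))] := schwarz_truncate adm t0.
rewrite rearrange_iter_truncate ?ltW // => eqK.
apply: sub_finite_set ((admissible_iter K adm).2 t t0) => x /= tx.
have /(congr1 (fun h => h x)) := eqK; rewrite /truncate tx.
by case: ifP => // _ h; move: tx; rewrite -h; lra.
Qed.

(** At a level t the truncated limit is reached after finitely many steps, and
    the later steps, among which e occurs again, do not change it. *)
Lemma schwarz_fixed u e : admissible u -> e \in es ->
  rearrange_step e (schwarz es u) = schwarz es u.
Proof.
move=> adm ees; have [f [q ax]] := direction_axis ((hes.2 e).1 ees).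
have adms := admissible_schwarz adm.
apply: truncate_inj => [x|x|t t0].
- by apply: (rearrange_step_ge0 ax adms.1).
- exact: adms.1.
rewrite -(rearrange_step_truncate ax) ?ltW //.
have [K HK] := schwarz_truncate adm t0.
pose k := (K * size es + index e es)%N.
have Kk : (K <= k)%N by have := directions_gt0; rewrite /k; nia.
rewrite -{2}(HK k.+1) ?leqW //= HK //.
by rewrite /k modnMDl modn_small ?index_mem // nth_index.
Qed.

Variables (G : R -> R -> R) (H : R -> R).
Hypotheses (hG : maps_Rplus2 G) (Gsuper : supermodular G) (G00 : G 0 0 = 0)
  (hH : maps_Rplus H) (Hdecr : decreasing_Rplus H).

Lemma riesz_truncate_le u v u' v' :
  (forall x, 0 <= u x) -> (forall x, 0 <= v x) ->
  (forall x, 0 <= u' x) -> (forall x, 0 <= v' x) ->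
  (forall t, 0 < t ->
     (riesz_sum G H (truncate t u) (truncate t v) <=
      riesz_sum G H (truncate t u') (truncate t v'))%E) ->
  (riesz_sum G H u v <= riesz_sum G H u' v')%E.
Proof. exact: (pair_sum_truncate_le hG Gsuper G00 (kernel_ge0 hH)). Qed.

Lemma riesz_step_le e u v : e \in es -> admissible u -> admissible v ->
  (riesz_sum G H u v <=
   riesz_sum G H (rearrange_step e u) (rearrange_step e v))%E.
Proof.
move=> ees au av; have [f [q ax]] := direction_axis ((hes.2 e).1 ees).
apply: riesz_truncate_le => [x|x|x|x|t t0]; [exact: au.1|exact: av.1| | |].
- exact: (rearrange_step_ge0 ax au.1).
- exact: (rearrange_step_ge0 ax av.1).
have t0' := ltW t0; rewrite -!(rearrange_step_truncate ax) //.
have [r ru] := truncate_ranked au t0; have [r' rv] := truncate_ranked av t0.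
exact: (riesz_step_ranked ax hG Gsuper hH Hdecr ru rv).
Qed.

Lemma riesz_iter_le j k u v : (j <= k)%N -> admissible u -> admissible v ->
  (riesz_sum G H (rearrange_iter es u j) (rearrange_iter es v j) <=
   riesz_sum G H (rearrange_iter es u k) (rearrange_iter es v k))%E.
Proof.
move=> jk au av; elim: k jk => [|k IH]; first by rewrite leqn0 => /eqP ->.
rewrite leq_eqVlt => /predU1P[-> //|]; rewrite ltnS => /IH {}IH.
apply: le_trans IH _; apply: riesz_step_le; rewrite ?mem_nth //.
- by rewrite ltn_mod directions_gt0.
- exact: admissible_iter.
- exact: admissible_iter.
Qed.

Lemma riesz_iter_schwarz_le j u v : admissible u -> admissible v ->
  (riesz_sum G H (rearrange_iter es u j) (rearrange_iter es v j) <=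
   riesz_sum G H (schwarz es u) (schwarz es v))%E.
Proof.
move=> au av; apply: riesz_truncate_le => [x|x|x|x|t t0].
- exact: (admissible_iter j au).1.
- exact: (admissible_iter j av).1.
- exact: schwarz_ge0.
- exact: schwarz_ge0.
have [Ku HKu] := schwarz_truncate au t0; have [Kv HKv] := schwarz_truncate av t0.
pose k := maxn j (maxn Ku Kv).
rewrite -(HKu k) ?leq_max ?leqnn ?orbT // -(HKv k) ?leq_max ?leqnn ?orbT //.
have t0' := ltW t0; rewrite -!rearrange_iter_truncate //.
by apply: riesz_iter_le; rewrite ?leq_max ?leqnn //; apply: admissible_truncate.
Qed.

End Schwarz.

(** * The equality case *)

Lemma polarize_fixed (R : realType) (T : choiceType) (sg : T -> T)
    (near : pred T) (u : T -> R) : reflection sg near ->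
  (forall x, near x -> u (sg x) <= u x) -> polarize sg near u = u.
Proof.
move=> refl u_near; apply/funext => x; have [sgK _ sg_fix] := refl.
rewrite /polarize; have [nx|nx] := boolP (near x).
  by apply/max_idPl/u_near.
have [nsx|nsx] := boolP (near (sg x)).
  by apply/min_idPl; have := u_near _ nsx; rewrite sgK.
by rewrite (sg_fix _ nx nsx) minxx.
Qed.

(** If the positive value u x were taken at two points, the list of the largest
    values would contain it twice in a row, at the places N + 1 and N + 2 where
    N is the number of points with a larger value. *)
Lemma strict_range_inj (R : realType) (T : choiceType) (u : T -> R) x y :
  admissible u -> strict_range u -> 0 < u x -> u x = u y -> x = y.
Proof.
move=> adm su ux uxy; apply/eqP; apply: contraT => xy.
have u0 := adm.1.
pose s := fset_set [set z | u x < u z] : seq T.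
have fin := adm.2 _ ux.
have sP z : (z \in s) = (u x < u z).
  by rewrite /s in_fset_set // ; apply/idP/idP; rewrite inE.
have us : uniq s by apply: fset_uniq.
have le1 : nth_largest setT u (size s).+1 <= u x.
  rewrite leNgt; apply/negP => /(nth_largest_gt setT adm (ltW ux) (ltn0Sn _)).
  case=> s' [us' sz' hs'].
  have : (size s' <= size s)%N.
    by apply: uniq_leq_size => // z /hs'[_]; rewrite sP.
  by rewrite sz' ltnn.
have lt2 := lt_le_trans (su (size s).+1 isT) le1.
have t0 := nth_largest_ge0 setT (size s).+2 u0.
suff : nth_largest setT u (size s).+2 < nth_largest setT u (size s).+2.
  by rewrite ltxx.
apply/(nth_largest_gt setT adm t0) => //; exists [:: x, y & s]; split => //.
  by rewrite /= inE negb_or xy us !sP uxy ltxx.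
move=> z; rewrite !inE => /or3P[/eqP -> //|/eqP ->|]; first by rewrite -uxy.
by rewrite sP => /(lt_trans lt2).
Qed.

Lemma lattice_ext (d : nat) (x y : lattice d) :
  (forall k, x ord0 k = y ord0 k) -> x = y.
Proof. by move=> xy; apply/rowP. Qed.

(** A function fixed by all rearrangements with an unbounded support is positive
    everywhere. From a point x with u x > 0 and |x_i| large, moves that go down
    in the order of some line do not decrease u: clear a coordinate other than
    the i-th one, then give it its target value along a diagonal, at the expense
    of the i-th coordinate. *)
Section Positivity.
Variables (R : realType) (d : nat) (u : lattice d -> R).
Hypotheses (adm : admissible u)
  (fixed : forall e, is_direction e -> rearrange_step e u = u).

Lemma coordinate_move (i : 'I_d) (x y : lattice d) :
  (forall k, k != i -> y ord0 k = x ord0 k) ->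
  (absz (y ord0 i) < absz (x ord0 i))%N \/ y ord0 i = `|x ord0 i| ->
  u x <= u y.
Proof.
move=> xy xyi; have e_dir : is_direction (unit_vec i) by left; exists i.
have ax := axis_unit_vec i; rewrite -(fixed e_dir).
apply: (rearrange_step_mono ax adm).
  apply/(axis_class ax); exists (x ord0 i - y ord0 i).
  apply: lattice_ext => k; rewrite !mxE eqxx /=.
  by have [->|ki] := eqVneq k i; [lia|rewrite xy //; lia].
rewrite /rank; case: xyi => [|->]; case: ifP; case: ifP; lia.
Qed.

Lemma diagonal_move (i j : 'I_d) (x y : lattice d) : i != j ->
  (forall k, k != i -> k != j -> y ord0 k = x ord0 k) ->
  x ord0 j = 0 -> (0 < absz (y ord0 j))%N -> `|y ord0 j| < x ord0 i ->
  y ord0 i = x ord0 i - `|y ord0 j| ->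
  u x <= u y.
Proof.
move=> ij xy xj yj0 yjx yi.
(* The diagonal on which the i-th coordinate decreases. *)
wlog [eps [eps1 epsE]] : / exists eps : int, (eps = 1 \/ eps = -1) /\
    `|y ord0 j| = - (eps * y ord0 j).
  apply; exists (if 0 < y ord0 j then -1 else 1).
  by case: ifP => yj; (split; last by lia); [right|left].
have [lt_ij|le_ji] := ltnP i j.
  have e_dir : is_direction (2^-1 *: (unit_vec i + eps%:~R *: unit_vec j)).
    right; exists i, j; split => //.
    by case: eps1 => ->; [left; rewrite scale1r|right; rewrite scaleN1r].
  have ax := axis_diagonal lt_ij eps1; rewrite -(fixed e_dir).
  apply: (rearrange_step_mono ax adm).
    apply/(axis_class ax); exists (`|y ord0 j|).
    apply: lattice_ext => k; rewrite !mxE eqxx /=.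
    have [->|ki] := eqVneq k i; first by rewrite (negPf ij) yi; lia.
    have [->|kj] := eqVneq k j; last by rewrite xy //; lia.
    by rewrite xj epsE; case: eps1 => ->; lia.
  by rewrite /rank xj yi; move: epsE; case: eps1 => -> epsE;
    case: ifP; case: ifP; lia.
have lt_ji : (j < i)%N by rewrite ltn_neqAle le_ji eq_sym andbT; exact: ij.
have e_dir : is_direction (2^-1 *: (unit_vec j + eps%:~R *: unit_vec i)).
  right; exists j, i; split => //.
  by case: eps1 => ->; [left; rewrite scale1r|right; rewrite scaleN1r].
have ax := axis_diagonal lt_ji eps1; rewrite -(fixed e_dir).
apply: (rearrange_step_mono ax adm).
  apply/(axis_class ax); exists (- y ord0 j).
  apply: lattice_ext => k; rewrite !mxE eqxx /=.
  have [->|ki] := eqVneq k i.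
    by rewrite (negPf ij) yi epsE; case: eps1 => ->; lia.
  have [->|kj] := eqVneq k j; last by rewrite xy //; lia.
  by rewrite xj; lia.
by rewrite /rank xj yi; move: epsE; case: eps1 => -> epsE;
  case: ifP; case: ifP; lia.
Qed.

(** The i-th coordinate has to pay |z_k| for every other coordinate k, and must
    still exceed |z_i| at the end. *)
Lemma positive_reach (i : 'I_d) (x z : lattice d) : 0 < u x ->
  (\sum_(k < d) absz (z ord0 k) < absz (x ord0 i))%N -> 0 < u z.
Proof.
move=> ux; rewrite (bigD1 i) //= => zx.
pose set_at (w : lattice d) j (b : int) : lattice d :=
  \row_k (if k == j then b else w ord0 k).
have reach (s : seq 'I_d) : uniq s -> i \notin s ->
    (\sum_(k <- s) absz (z ord0 k) < absz (x ord0 i))%N ->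
    exists y, [/\ 0 < u y,
      `|x ord0 i| <= y ord0 i + (\sum_(k <- s) absz (z ord0 k))%N%:Z
      & forall k, k \in s -> y ord0 k = z ord0 k].
  elim: s => [|j s IH] /=.
    move=> _ _ _; exists (set_at x i `|x ord0 i|); split => //.
    + apply: lt_le_trans ux _; apply: (@coordinate_move i).
        by move=> k /negPf ki; rewrite mxE ki.
      by right; rewrite mxE eqxx.
    + by rewrite mxE eqxx big_nil; lia.
  rewrite inE negb_or => /andP[js us] /andP[ij is_]; rewrite !big_cons => sx.
  have [|y [uy yi ys]] := IH us is_; first by lia.
  have ji : j != i by rewrite eq_sym.
  pose y0 := set_at y j 0.
  have uy0 : 0 < u y0.
    apply: lt_le_trans uy _; apply: (@coordinate_move j).
      by move=> k /negPf kj; rewrite mxE kj.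
    by rewrite mxE eqxx; lia.
  have y0i : y0 ord0 i = y ord0 i by rewrite mxE (negPf ij).
  have y0j : y0 ord0 j = 0 by rewrite mxE eqxx.
  have y0s k : k \in s -> y0 ord0 k = z ord0 k.
    move=> ks; rewrite mxE; case: eqP => [kj|_]; last exact: ys.
    by move: js; rewrite -kj ks.
  have [zj|zj] := eqVneq (z ord0 j) 0.
    exists y0; split => //; first by rewrite y0i zj; lia.
    by move=> k; rewrite inE => /predU1P[->|/y0s //]; rewrite y0j zj.
  pose y1 := set_at (set_at y0 j (z ord0 j)) i (y ord0 i - `|z ord0 j|).
  have y1i : y1 ord0 i = y ord0 i - `|z ord0 j| by rewrite mxE eqxx.
  have y1j : y1 ord0 j = z ord0 j by rewrite mxE (negPf ji) mxE eqxx.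
  have y1k k : k != i -> k != j -> y1 ord0 k = y0 ord0 k.
    by move=> /negPf ki /negPf kj; rewrite 2!mxE ki kj.
  exists y1; split.
  + apply: lt_le_trans uy0 _; apply: (@diagonal_move i j) => //;
      rewrite ?y1i ?y1j ?y0i //; lia.
  + by rewrite y1i; lia.
  + move=> k; rewrite inE => /predU1P[->|ks]; first by rewrite y1j.
    rewrite y1k ?y0s //; first by apply: contraNneq is_ => <-.
    by apply: contraNneq js => <-.
have [||| y [uy yi ys]] := reach [seq k <- index_enum 'I_d | k != i].
- by rewrite filter_uniq // index_enum_uniq.
- by rewrite mem_filter eqxx.
- by apply: leq_ltn_trans zx; rewrite big_filter leq_addl.
have {}yi : `|x ord0 i| <=
    y ord0 i + (\sum_(k < d | k != i) absz (z ord0 k))%N%:Z.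
  by move: yi; rewrite big_filter.
apply: lt_le_trans uy _; apply: (@coordinate_move i).
  by move=> k ki; rewrite ys // mem_filter ki mem_index_enum.
by left; move: zx yi; move: (\sum_(k < d | k != i) absz (z ord0 k))%N; lia.
Qed.

Lemma box_card (M : nat) (s : seq (lattice d)) : uniq s ->
  (forall x, x \in s -> forall k, (absz (x ord0 k) <= M)%N) ->
  (size s <= #|{: 'rV['I_(M + M).+1]_d}|)%N.
Proof.
move=> us hs.
pose h (x : lattice d) : 'rV['I_(M + M).+1]_d :=
  \row_k inord (absz (x ord0 k + M%:Z)).
have shift_lt (a : int) : (absz a <= M)%N -> (absz (a + M%:Z)%R < (M + M).+1)%N.
  by lia.
have shift_inj (a b : int) : (absz a <= M)%N -> (absz b <= M)%N ->
    absz (a + M%:Z) = absz (b + M%:Z) -> a = b by lia.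
rewrite -(size_map h) -(card_uniqP _); first exact: max_card.
rewrite map_inj_in_uniq // => x y /hs xM /hs yM /rowP hxy; apply: lattice_ext => k.
have /(congr1 (@nat_of_ord _)) := hxy k; rewrite !mxE.
by rewrite !inordK ?shift_lt //; apply: shift_inj.
Qed.

(** Infinitely many distinct values force infinitely many points with u > 0, and
    a box contains only finitely many of them. *)
Lemma strict_range_gt0 : strict_range u -> forall z, 0 < u z.
Proof.
move=> su z; pose M := (\sum_(k < d) absz (z ord0 k))%N.
have many_n n : many setT u 0 n.+1.
  apply/(nth_largest_gt setT adm (lexx _)) => //.
  exact: le_lt_trans (nth_largest_ge0 _ _ adm.1) (su n.+1 isT).
have [s [us sz hs]] := many_n #|{: 'rV['I_(M + M).+1]_d}|.
have [x [xs [i Mx]]] : exists x, x \in s /\ exists i, (M < absz (x ord0 i))%N.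
  apply: contrapT => small; have : (size s <= #|{: 'rV['I_(M + M).+1]_d}|)%N.
    apply: box_card us _ => x xs k; rewrite leqNgt; apply/negP => Mx.
    by apply: small; exists x; split => //; exists k.
  by rewrite sz ltnn.
exact: positive_reach (hs x xs).2 Mx.
Qed.

End Positivity.

(** The comparison passes through a polarization w of v rather than through the
    rearrangement of v, because strictness is visible on a single orbit; w has
    the same rearrangement, so nothing is lost by the later steps. *)
Lemma riesz_step_lt (R : realType) (d : nat) (e : 'rV[rat]_d)
    (G : R -> R -> R) (H : R -> R) (u v : lattice d -> R) :
  is_direction e -> maps_Rplus2 G -> strictly_supermodular G ->
  maps_Rplus H -> decreasing_Rplus H -> (exists n : nat, H n.+1%:R < H n%:R) ->
  admissible u -> admissible v ->
  (forall x, 0 < u x) -> injective u -> rearrange_step e u = u ->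
  rearrange_step e v <> v ->
  exists w, [/\ admissible w, rearrange_step e w = rearrange_step e v
    & (riesz_sum G H u w < +oo)%E -> (riesz_sum G H u v < riesz_sum G H u w)%E].
Proof.
move=> e_dir hG Gs hH Hdecr [n Hn] au av upos uinj Ru Rv.
have [f [q ax]] := direction_axis e_dir.
have refl c := axis_reflection ax c.
have [c Pv] : exists c,
    polarize (reflect_axis f q c) (near_side q c) v <> v.
  apply: contrapT => noP; apply: Rv; apply: (rearrange_step_fixed ax av) => c.
  by apply: contrapT => Pv; apply: noP; exists c.
have [y ny vy] : exists2 y, near_side q c y & v y < v (reflect_axis f q c y).
  apply: contrapT => noy; apply: Pv; apply: polarize_fixed => // y ny.
  by rewrite leNgt; apply/negP => vy; apply: noy; exists y.
have u_near x : near_side q c x -> u (reflect_axis f q c x) <= u x.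
  move=> nx; rewrite -Ru; apply: (rearrange_step_mono ax au).
    exact: class_reflect.
  exact/ltnW/(rank_near ax).
exists (polarize (reflect_axis f q c) (near_side q c) v); split.
- have [pi [piK _ ->]] := polarize_perm (refl c) v; exact: admissible_perm.
- exact: rearrange_step_polarize.
have [x [nx dxy dxsy]] := axis_separates ax n ny.
apply: (pair_sum_polarize_lt (refl c) hG Gs.1 (kernel_ge0 hH)
  (kernel_isometry ax H c) (@kernel_fold _ _ _ _ _ ax _ Hdecr c)
  au.1 av.1 Gs _ nx ny _ vy).
- exact: polarize_fixed.
- rewrite lt_neqAle u_near // andbT; apply/eqP => /uinj sx.
  by have := reflection_near (refl c) nx; rewrite sx nx.
- rewrite dxy; apply: le_lt_trans Hn; apply: Hdecr; rewrite ?ler0n //.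
  by rewrite ler_nat.
Qed.

Theorem theorem1p2 (R : realType) (d : nat) (hd : (1 <= d)%N)
    (es : seq 'rV[rat]_d) (hes : enumerates_directions es)
    (u v : 'rV[int]_d -> R) (hu : admissible u) (hv : admissible v)
    (H : R -> R) (hH : maps_Rplus H) (Hdecr : decreasing_Rplus H)
    (G : R -> R -> R) (hG : maps_Rplus2 G) (Gsuper : supermodular G)
    (G00 : G 0 0 = 0) :
  (riesz_sum G H u v <= riesz_sum G H (schwarz es u) (schwarz es v))%E /\
  (u = schwarz es u -> strict_range u -> strictly_supermodular G ->
   (exists n : nat, H n.+1%:R < H n%:R) ->
   (`|riesz_sum G H (schwarz es u) (schwarz es v)| < +oo)%E ->
   (riesz_sum G H u v = riesz_sum G H (schwarz es u) (schwarz es v) <->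
    v = schwarz es v)).
Proof.
have iter_le k := riesz_iter_schwarz_le hd hes hG Gsuper G00 hH Hdecr k hu hv.
split; first exact: (iter_le 0%N).
move=> u_eq su Gs Hn fin; split=> [eq_sum|v_eq]; last by rewrite -u_eq -v_eq.
have Rfixed e : e \in es -> rearrange_step e u = u.
  by move=> ees; rewrite u_eq schwarz_fixed.
have upos : forall x, 0 < u x.
  by apply: strict_range_gt0 => // e /hes.2; apply: Rfixed.
have uinj : injective u by move=> x y; apply: strict_range_inj.
apply: contrapT => v_neq.
(* The first step that changes v. *)
have [k [vk Rvk]] : exists k, rearrange_iter es v k = v /\
    rearrange_step (nth 0 es (k %% size es)%N) v <> v.
  apply: contrapT => no_k; apply: v_neq.
  have vk k : rearrange_iter es v k = v.
    elim: k => //= k vk; rewrite vk; apply: contrapT => Rv.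
    by apply: no_k; exists k.
  apply/funext => x; apply/esym/cvg_lim => //; apply: cvg_near_cst.
  by exists 0%N => // k _ /=; rewrite vk.
have uk j : rearrange_iter es u j = u.
  elim: j => //= j ->; apply: Rfixed.
  by rewrite mem_nth // ltn_mod (directions_gt0 hd hes).
have ees : nth 0 es (k %% size es)%N \in es.
  by rewrite mem_nth // ltn_mod (directions_gt0 hd hes).
have [w [aw Rw lt_w]] := riesz_step_lt ((hes.2 _).1 ees) hG Gs hH Hdecr Hn
  hu hv upos uinj (Rfixed _ ees) Rvk.
have le_w : (riesz_sum G H u w <=
    riesz_sum G H (schwarz es u) (schwarz es v))%E.
  apply: le_trans (riesz_step_le hes hG Gsuper G00 hH Hdecr ees hu aw) _.
  by have := iter_le k.+1; rewrite /= uk vk Rw.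
have : (riesz_sum G H u v < riesz_sum G H u w)%E.
  by apply: lt_w; apply: le_lt_trans le_w _; apply: le_lt_trans fin; apply: lee_abs.
by rewrite eq_sum ltNge le_w.
Qed.
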